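(* Let $L$ be an irreducible $\hat{\mathfrak g}$-module such that for every $v\in L$ one has $(\mathfrak g\otimes t^k\mathbb C[t])v=0$ for all sufficiently large $k\in\mathbb N$. Let $m\in\mathbb N$, let $\mathbf a=(a_1,\dots,a_m)\in\mathbb C^m$ have nonzero, pairwise distinct entries, let $\boldsymbol\lambda\in(\mathfrak h^* )^m\setminus\{0\}$, and put $M=E(\boldsymbol\lambda,\mathbf a)\otimes L$. Then the induced $\tilde{\mathfrak g}$-module $M[d]$ is irreducible.
   Context: $\mathfrak g$ is a finite-dimensional simple Lie algebra over $\mathbb C$ with Cartan subalgebra $\mathfrak h$, a fixed base of its root system, and triangular decomposition $\mathfrak g=\mathfrak n_-\oplus\mathfrak h\oplus\mathfrak n_+$. $\tilde{\mathfrak g}=\mathfrak g\otimes\mathbb C[t,t^{-1}]\oplus\mathbb CK\oplus\mathbb Cd$ is the untwisted affine Kac-Moody algebra, with $K$ central, $[x\otimes t^m,y\otimes t^n]=[x,y]\otimes t^{m+n}+(x|y)\,m\,\delta_{m+n,0}K$ and $[d,x\otimes t^m]=m\,x\otimes t^m$, where $(\cdot|\cdot)$ is the Killing form of $\mathfrak g$; $\hat{\mathfrak g}=\mathfrak g\otimes\mathbb C[t,t^{-1}]\oplus\mathbb CK$. For $\lambda\in\mathfrak h^*$, $V(\lambda)$ is the irreducible highest weight $\mathfrak g$-module of highest weight $\lambda$ (possibly infinite-dimensional). For $\boldsymbol\lambda=(\lambda_1,\dots,\lambda_m)\in(\mathfrak h^* )^m$ and $\mathbf a=(a_1,\dots,a_m)$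 with nonzero pairwise distinct entries, $E(\boldsymbol\lambda,\mathbf a)$ is the $\hat{\mathfrak g}$-module $V(\lambda_1)\otimes\cdots\otimes V(\lambda_m)$ with $K$ acting as $0$ and $(x\otimes t^k)(v_1\otimes\cdots\otimes v_m)=\sum_{i=1}^m a_i^k\,v_1\otimes\cdots\otimes xv_i\otimes\cdots\otimes v_m$ for $x\in\mathfrak g$, $k\in\mathbb Z$. For a $\hat{\mathfrak g}$-module $M$, $M[d]=\mathrm{Ind}_{\hat{\mathfrak g}}^{\tilde{\mathfrak g}}M=U(\tilde{\mathfrak g})\otimes_{U(\hat{\mathfrak g})}M$. $\mathbb N$ denotes the positive integers. *)

(* Defs.v *)
From HB Require Import structures.
From mathcomp Require Import all_boot all_order all_algebra.
From mathcomp Require Import generic_quotient ring_quotient.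
From mathcomp Require Import boolp classical_sets functions cardinality fsbigop.
From mathcomp Require Import reals complex.

Set Implicit Arguments.
Unset Strict Implicit.
Unset Printing Implicit Defensive.

Import GRing.Theory Num.Theory.
Local Open Scope ring_scope.
Local Open Scope quotient_scope.
Local Open Scope complex_scope.

(* Finitely supported families [I -> V].  This is [V (x) F^(I)]: for [V = F^o] *)
(* it is the free vector space on [I], and for [I = int] it is the space       *)
(* [V (x) F[t, t^-1]], with [fsingle n v] standing for [v (x) t^n].            *)

Section FSupp.
Variables (F : fieldType) (I : choiceType) (V : lmodType F).

Definition fsupp_pred : {pred I -> V} :=
  fun f => `[< finite_set [set i | f i <> 0] >].

Record fsupp := FSupp { fsupp_fun :> I -> V; _ : fsupp_fun \in fsupp_pred }.

HB.instance Definition _ := [isSub for fsupp_fun].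
HB.instance Definition _ := [Choice of fsupp by <:].

Lemma fsupp_submod_closed : GRing.submod_closed fsupp_pred.
Proof.
split=> [|c f g].
  apply/asboolP; rewrite (_ : [set _ | _] = set0)%classic ?finite_set0 //.
  by apply/seteqP; split=> // i /=; exact.
move=> /asboolP Pf /asboolP Pg; apply/asboolP.
apply: (@sub_finite_set _ _ ([set i | f i <> 0] `|` [set i | g i <> 0])%classic).
  move=> i /= nz; apply: contrapT => /not_orP[/contrapT f0 /contrapT g0].
  by apply: nz; rewrite -[LHS]/(c *: f i + g i) f0 g0 scaler0 addr0.
by rewrite finite_setU.
Qed.

HB.instance Definition _ :=
  GRing.isSubmodClosed.Build F (I -> V) fsupp_pred fsupp_submod_closed.
HB.instance Definition _ := [SubChoice_isSubLmodule of fsupp by <:].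

End FSupp.

Section FSuppTheory.
Variables (F : fieldType) (I : choiceType).
Implicit Types V W : lmodType F.

Definition fsingle_fun V (i : I) (v : V) : I -> V :=
  fun j => if j == i then v else 0.

Lemma fsingle_subproof V i (v : V) : fsingle_fun i v \in fsupp_pred (V := V).
Proof.
apply/asboolP; apply: (@sub_finite_set _ _ [set i]%classic) => //.
by move=> j; rewrite /= /fsingle_fun; case: eqP.
Qed.

Definition fsingle V i (v : V) : fsupp I V := FSupp (fsingle_subproof i v).

(* The linear map [v (x) i |-> phi i v]. *)
Definition fext V W (phi : I -> V -> W) (f : fsupp I V) : W :=
  \sum_(i \in [set: I]) phi i (f i).

Lemma fsupp_eqP V (f g : fsupp I V) : f =1 g -> f = g.
Proof. by move=> fg; apply: val_inj; apply/funext. Qed.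

Lemma fsuppDE V (f g : fsupp I V) i : (f + g) i = f i + g i.
Proof. by []. Qed.

Lemma fsuppZE V c (f : fsupp I V) i : (c *: f) i = c *: f i.
Proof. by []. Qed.

Lemma fsupp0E V i : (0 : fsupp I V) i = 0.
Proof. by []. Qed.

Lemma fsupp_sumE V (J : Type) (r : seq J) (P : pred J) (G : J -> fsupp I V) i :
  (\sum_(j <- r | P j) G j) i = \sum_(j <- r | P j) G j i.
Proof.
by elim/big_rec2: _ => [|j y1 y2 _ <-]; rewrite ?fsupp0E ?fsuppDE.
Qed.

Lemma fsingle_linear V i : linear (@fsingle V i).
Proof.
move=> c u v; apply: fsupp_eqP => j; rewrite fsuppDE fsuppZE /= /fsingle_fun.
by case: ifP => // _; rewrite scaler0 addr0.
Qed.

HB.instance Definition _ V i :=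
  GRing.isLinear.Build F V (fsupp I V) *:%R (@fsingle V i) (fsingle_linear i).

Lemma fsupp_finite V (f : fsupp I V) : finite_set [set i | f i <> 0].
Proof. by case: f => f Pf; exact/asboolP. Qed.

Lemma fsupp_seq V (f : fsupp I V) :
  exists2 s : seq I, uniq s & forall i, i \notin s -> f i = 0.
Proof.
have /finite_seqP[s sE] := fsupp_finite f; exists (undup s).
  exact: undup_uniq.
move=> i; rewrite mem_undup => /negP nsi; apply: contrapT => nz.
by apply: nsi; have : [set` s]%classic i by rewrite -sE.
Qed.

Lemma fext_seq V W (phi : I -> V -> W) (f : fsupp I V) (s : seq I) :
  (forall i, phi i 0 = 0) -> uniq s -> (forall i, i \notin s -> f i = 0) ->
  fext phi f = \sum_(i <- s) phi i (f i).
Proof.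
move=> phi0 us sP; rewrite fsbig_seq //= /fext; apply/esym/fsbig_widen => //.
by move=> i [_ /= /negP /sP ->].
Qed.

Lemma fsupp_ind V (P : fsupp I V -> Prop) :
  P 0 -> (forall f g, P f -> P g -> P (f + g)) ->
  (forall i v, P (fsingle i v)) -> forall f, P f.
Proof.
move=> P0 PD P1 f; have [s us sP] := fsupp_seq f.
suff -> : f = \sum_(i <- s) fsingle i (f i) by elim/big_rec: _ => // i g _; apply: PD.
apply: fsupp_eqP => j; rewrite fsupp_sumE.
have [js|js] := boolP (j \in s); last first.
  rewrite sP // big1_seq // => i /andP[_ si] /=; rewrite /fsingle_fun.
  by case: eqP => // ji; rewrite ji si in js.
rewrite (bigD1_seq j) //= /fsingle_fun eqxx big1 ?addr0 // => i /negPf.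
by rewrite eq_sym => ->.
Qed.

Lemma fext_linear V W (phi : I -> V -> W) :
  (forall i, linear (phi i)) -> linear (fext phi).
Proof.
move=> phil c f g; pose L i : {linear V -> W} := HB.pack (phi i) (GRing.isLinear.Build _ _ _ _ _ (phil i)).
have phi0 i : phi i 0 = 0 by exact: (linear0 (L i)).
have [s us sP] := fsupp_seq f; have [t ut tP] := fsupp_seq g.
pose r := undup (s ++ t).
have rP i : i \notin r -> i \notin s /\ i \notin t.
  by rewrite mem_undup mem_cat negb_or => /andP[].
rewrite !(@fext_seq _ _ _ _ r) ?undup_uniq //.
- by rewrite scaler_sumr -big_split /=; apply: eq_bigr => i _; rewrite phil.
- by move=> i /rP[? /tP].
- by move=> i /rP[/sP].
- by move=> i /rP[/sP fi /tP gi]; rewrite fsuppDE fsuppZE fi gi scaler0 addr0.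
Qed.

Lemma fext_single V W (phi : I -> V -> W) i v :
  (forall i, phi i 0 = 0) -> fext phi (fsingle i v) = phi i v.
Proof.
move=> phi0; rewrite (@fext_seq _ _ _ _ [:: i]) //.
  by rewrite big_seq1 /= /fsingle_fun eqxx.
by move=> j; rewrite inE /= /fsingle_fun => /negPf ->.
Qed.

Lemma linear_fun0 V W (f : V -> W) : linear f -> f 0 = 0.
Proof. by move=> fl; exact: (linear0 (HB.pack f (GRing.isLinear.Build _ _ _ _ _ fl) : {linear V -> W})). Qed.

Lemma linear_funD V W (f : V -> W) : linear f -> {morph f : u v / u + v}.
Proof. by move=> fl u v; have := fl 1 u v; rewrite !scale1r. Qed.

Lemma linear_funZ V W (f : V -> W) : linear f -> forall c, {morph f : u / c *: u}.
Proof. by move=> fl c u; have := fl c u 0; rewrite !addr0 (linear_fun0 fl) addr0. Qed.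

Lemma linear_funN V W (f : V -> W) : linear f -> {morph f : u / - u}.
Proof. by move=> fl u; rewrite -scaleN1r (linear_funZ fl) scaleN1r. Qed.

Lemma linear_funB V W (f : V -> W) : linear f -> {morph f : u v / u - v}.
Proof. by move=> fl u v; rewrite (linear_funD fl) (linear_funN fl). Qed.

Lemma fext_linE V W (phi : I -> V -> W) i v :
  (forall i, linear (phi i)) -> fext phi (fsingle i v) = phi i v.
Proof. by move=> phil; rewrite fext_single // => j; exact: linear_fun0. Qed.

Lemma fext_combo V W (phi psi chi : I -> V -> W) c f :
  (forall i, linear (phi i)) -> (forall i, linear (psi i)) ->
  (forall i v, chi i v = c *: phi i v + psi i v) ->
  fext chi f = c *: fext phi f + fext psi f.
Proof.
move=> phil psil chiE.
have phi0 i := linear_fun0 (phil i); have psi0 i := linear_fun0 (psil i).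
have [s us sP] := fsupp_seq f; rewrite !(@fext_seq _ _ _ _ s) //.
  by rewrite scaler_sumr -big_split; apply: eq_bigr => i _.
by move=> i; rewrite chiE phi0 psi0 scaler0 addr0.
Qed.

(* Linear maps out of [fsupp I V] are determined by the values on [fsingle]. *)
Lemma fsupp_lin_ext V W (p q : fsupp I V -> W) : linear p -> linear q ->
  (forall i v, p (fsingle i v) = q (fsingle i v)) -> p =1 q.
Proof.
move=> pl ql pq f; elim/fsupp_ind: f => //.
- by rewrite (linear_fun0 pl) (linear_fun0 ql).
- by move=> f g pf pg; rewrite (linear_funD pl) (linear_funD ql) pf pg.
Qed.

End FSuppTheory.

Section FExt2.
Variables (F : fieldType) (I J : choiceType) (V V' W : lmodType F).
Variable b : I -> J -> V -> V' -> W.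

(* The bilinear map [(v (x) i, v' (x) j) |-> b i j v v']. *)
Definition fext2 (f : fsupp I V) (f' : fsupp J V') : W :=
  fext (fun i v => fext (fun j v' => b i j v v') f') f.

Hypothesis bl : forall i j v', linear (fun v => b i j v v').
Hypothesis br : forall i j v, linear (b i j v).

Lemma fext2_linear_r f : linear (fext2 f).
Proof.
move=> c f' f''; rewrite /fext2; apply: fext_combo => [i|i|i v].
- by move=> d x y; apply: fext_combo => [j|j|j z]; [exact: br..|exact: bl].
- by move=> d x y; apply: fext_combo => [j|j|j z]; [exact: br..|exact: bl].
- by apply: fext_linear => j; exact: br.
Qed.

Lemma fext2_linear_l f' : linear (fext2 ^~ f').
Proof.
apply: fext_linear => i c x y.
by apply: fext_combo => [j|j|j z]; [exact: br..|exact: bl].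
Qed.

Lemma fext2E i j v v' : fext2 (fsingle i v) (fsingle j v') = b i j v v'.
Proof.
rewrite /fext2 fext_linE => [|k]; first by rewrite fext_linE // => k; exact: br.
by move=> c x y; apply: fext_combo => [l|l|l z]; [exact: br..|exact: bl].
Qed.

End FExt2.

Section Quotient.
Variables (F : fieldType) (V : lmodType F) (P : set V).

Inductive lspan : V -> Prop :=
| lspan0 : lspan 0
| lspan_step c u v : P u -> lspan v -> lspan (c *: u + v).

Definition lspan_pred : {pred V} := fun v => `[< lspan v >].

Lemma lspanD u v : lspan u -> lspan v -> lspan (u + v).
Proof.
move=> su sv; elim: su => [|c x y Px _ IH]; first by rewrite add0r.
by rewrite -addrA; exact: lspan_step.
Qed.

Lemma lspanZ c v : lspan v -> lspan (c *: v).
Proof.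
elim=> [|d x y Px _ IH]; first by rewrite scaler0; exact: lspan0.
by rewrite scalerDr scalerA; exact: lspan_step.
Qed.

Lemma lspan_in v : P v -> lspan v.
Proof. by move=> Pv; rewrite -[v]scale1r -[_ *: _]addr0; apply: lspan_step => //; exact: lspan0. Qed.

Lemma lspan_ker (W : lmodType F) (f : V -> W) :
  linear f -> (forall r, P r -> f r = 0) -> forall v, lspan v -> f v = 0.
Proof.
move=> fl fP v; elim=> [|c x y Px _ IH]; first exact: linear_fun0.
by rewrite fl fP // IH scaler0 addr0.
Qed.

Lemma lspan_zmod_closed : zmod_closed lspan_pred.
Proof.
split=> [|u v /asboolP su /asboolP sv]; apply/asboolP; first exact: lspan0.
by apply: lspanD su _; rewrite -scaleN1r; exact: lspanZ.
Qed.

HB.instance Definition _ := GRing.isZmodClosed.Build V lspan_pred lspan_zmod_closed.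

Definition qmod : Type := (Quotient.quot lspan_pred).
HB.instance Definition _ := GRing.Zmodule.on qmod.

Definition qpi (v : V) : qmod := \pi_(Quotient.quot lspan_pred) v.
Definition qrepr (q : qmod) : V := repr (q : (Quotient.quot lspan_pred)).

Lemma qreprK q : qpi (qrepr q) = q.
Proof. exact: reprK. Qed.

Lemma qpi_eq u v : qpi u = qpi v <-> lspan (u - v).
Proof.
rewrite /qpi; split.
  by move=> /eqP; rewrite -Quotient.idealrBE => /asboolP.
by move=> uv; apply/eqP; rewrite -Quotient.idealrBE; exact/asboolP.
Qed.

Lemma qpiD : {morph qpi : u v / u + v}.
Proof. by move=> u v; rewrite /qpi raddfD. Qed.

Definition qscale (c : F) (q : qmod) : qmod := qpi (c *: qrepr q).

Lemma qpiZ c v : qscale c (qpi v) = qpi (c *: v).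
Proof.
apply/qpi_eq; rewrite -scalerBr; apply/lspanZ/qpi_eq; exact: qreprK.
Qed.

Lemma qscalerA a b q : qscale a (qscale b q) = qscale (a * b) q.
Proof. by rewrite -(qreprK q) !qpiZ scalerA. Qed.

Lemma qscale1r : left_id 1 qscale.
Proof. by move=> q; rewrite -(qreprK q) qpiZ scale1r. Qed.

Lemma qscalerDr : right_distributive qscale +%R.
Proof.
by move=> c q r; rewrite -(qreprK q) -(qreprK r) -qpiD !qpiZ scalerDr qpiD.
Qed.

Lemma qscalerDl q : {morph qscale^~ q : a b / a + b}.
Proof. by move=> a b; rewrite -(qreprK q) !qpiZ scalerDl qpiD. Qed.

HB.instance Definition _ := GRing.Zmodule_isLmodule.Build F qmod
  qscalerA qscale1r qscalerDr qscalerDl.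

Lemma qpi_linear : linear qpi.
Proof. by move=> c u v; rewrite qpiD -qpiZ. Qed.

HB.instance Definition _ := GRing.isLinear.Build F V qmod *:%R qpi qpi_linear.

Lemma qpi0 r : P r -> qpi r = 0.
Proof. by move=> Pr; rewrite -(linear0 qpi); apply/qpi_eq; rewrite subr0; exact: lspan_in. Qed.

Variant qmod_spec : qmod -> Type := QmodSpec v : qmod_spec (qpi v).

Lemma qmodP q : qmod_spec q.
Proof. by rewrite -(qreprK q). Qed.

(* The map induced on the quotient by [f]; meaningful when [f] kills [P]. *)
Definition qlift (W : lmodType F) (f : V -> W) (q : qmod) : W := f (qrepr q).

Lemma qliftE (W : lmodType F) (f : V -> W) v :
  linear f -> (forall r, P r -> f r = 0) -> qlift f (qpi v) = f v.
Proof.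
move=> fl fP; apply/eqP; rewrite -subr_eq0 -(linear_funB fl); apply/eqP.
by apply: (lspan_ker fl fP); apply/qpi_eq; exact: qreprK.
Qed.

Lemma qlift_linear (W : lmodType F) (f : V -> W) :
  linear f -> (forall r, P r -> f r = 0) -> linear (qlift f).
Proof.
move=> fl fP c q r; case: (qmodP q) => u; case: (qmodP r) => v.
by rewrite -linearP !qliftE // fl.
Qed.

End Quotient.

HB.mixin Record isLieAlgebra (F : fieldType) (g : Type) of GRing.Lmodule F g := {
  bracket : g -> g -> g;
  bracket_linear_l : forall y, linear (bracket ^~ y);
  bracket_linear_r : forall x, linear (bracket x);
  bracketxx : forall x, bracket x x = 0;
  jacobi : forall x y z,
    bracket x (bracket y z) + bracket y (bracket z x) + bracket z (bracket x y) = 0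
}.

#[short(type="lieAlgType")]
HB.structure Definition LieAlgebra (F : fieldType) :=
  { g of GRing.Lmodule F g & isLieAlgebra F g }.

#[short(type="finLieAlgType")]
HB.structure Definition FinLieAlgebra (F : fieldType) :=
  { g of Vector F g & isLieAlgebra F g }.

Section LieTheory.
Variables (F : fieldType) (g : lieAlgType F).
Implicit Types x y z : g.

HB.instance Definition _ x :=
  GRing.isLinear.Build F g g *:%R (bracket x) (bracket_linear_r x).

Lemma bracketDl x y z : bracket (x + y) z = bracket x z + bracket y z.
Proof. exact: (linear_funD (bracket_linear_l z)). Qed.

Lemma bracketZl c x z : bracket (c *: x) z = c *: bracket x z.
Proof. exact: (linear_funZ (bracket_linear_l z)). Qed.

Lemma bracketDr x y z : bracket x (y + z) = bracket x y + bracket x z.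
Proof. exact: linearD. Qed.

Lemma bracketZr c x z : bracket x (c *: z) = c *: bracket x z.
Proof. exact: linearZ. Qed.

Lemma bracket0l x : bracket 0 x = 0.
Proof. exact: (linear_fun0 (bracket_linear_l x)). Qed.

Lemma bracket0r x : bracket x 0 = 0.
Proof. exact: linear0. Qed.

Lemma bracketC x y : bracket x y = - bracket y x.
Proof.
apply/eqP; rewrite -addr_eq0; have := bracketxx (x + y).
by rewrite bracketDl !bracketDr !bracketxx add0r addr0 => ->.
Qed.

Lemma bracket_bracket x y z :
  bracket (bracket x y) z = bracket x (bracket y z) - bracket y (bracket x z).
Proof.
have /eqP := jacobi x y z; rewrite addr_eq0 => /eqP.
by rewrite (bracketC z (bracket x y)) opprK (bracketC z x) linearN => ->.
Qed.

End LieTheory.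

(* A [g]-module; bundled as a record and not as a canonical structure because  *)
(* one space carries actions of several Lie algebras.                          *)
Record lieMod (F : fieldType) (g : lieAlgType F) := LieMod {
  lm_sort :> lmodType F;
  lm_act : g -> lm_sort -> lm_sort;
  lm_act_linear_l : forall v, linear (lm_act ^~ v);
  lm_act_linear_r : forall x, linear (lm_act x);
  lm_act_bracket : forall x y v,
    lm_act (bracket x y) v = lm_act x (lm_act y v) - lm_act y (lm_act x v)
}.

Section LieModules.
Variables (F : fieldType) (g : lieAlgType F).

Definition submodule (M : lieMod g) (W : set M) : Prop :=
  [/\ W 0, forall c u v, W u -> W v -> W (c *: u + v)
    & forall x v, W v -> W (lm_act x v)].

Definition irreducible (M : lieMod g) : Prop :=
  (exists v : M, v <> 0) /\
  forall W : set M, submodule W ->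
    (forall v, W v -> v = 0) \/ (forall v, W v).

End LieModules.

Section FinLie.
Import passmx.
Variables (F : fieldType) (g : finLieAlgType F).
Implicit Types (h : {vspace g}) (x y z : g).

Definition ad x : 'End(g) := linfun (bracket x).

Definition ad_mx x : 'M[F]_(\dim {:g}) :=
  mxof (vbasis {:g}) (vbasis {:g}) (ad x).

(* [mxof] acts on row vectors, so this is [tr (ad y \o ad x)], which equals       *)
(* [tr (ad x \o ad y)].                                                         *)
Definition killing x y : F := \tr (ad_mx x *m ad_mx y).

Lemma adE x z : ad x z = bracket x z.
Proof. by rewrite lfunE. Qed.

Lemma ad_linear : linear ad.
Proof.
move=> c x y; apply/lfunP => z.
by rewrite !lfunE /= !lfunE /= adE bracketDl bracketZl.
Qed.

Lemma ad_bracket x y : ad (bracket x y) = (ad x \o ad y)%VF - (ad y \o ad x)%VF.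
Proof.
apply/lfunP => z.
by rewrite adE bracket_bracket add_lfunE opp_lfunE !comp_lfunE !adE.
Qed.

Lemma ad_mx_linear : linear ad_mx.
Proof. by move=> c x y; rewrite /ad_mx ad_linear linearP. Qed.

Lemma ad_mx_bracket x y :
  ad_mx (bracket x y) = ad_mx y *m ad_mx x - ad_mx x *m ad_mx y.
Proof.
rewrite /ad_mx ad_bracket linearB /=.
by rewrite !(mxof_comp _ _ (vbasisP {:g})).
Qed.

Lemma killingC x y : killing x y = killing y x.
Proof. by rewrite /killing mxtrace_mulC. Qed.

Lemma killing_linear_l y : linear (fun x => killing x y : F^o).
Proof.
move=> c u v; rewrite /killing ad_mx_linear.
by rewrite mulmxDl -scalemxAl mxtraceD mxtraceZ.
Qed.

Lemma killing_linear_r x : linear (fun y => killing x y : F^o).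
Proof.
by move=> c u v; rewrite !(killingC x); exact: (killing_linear_l x c u v).
Qed.

Lemma killing_invariant x y z : killing (bracket x y) z = killing x (bracket y z).
Proof.
rewrite /killing !ad_mx_bracket mulmxBl mulmxBr !raddfB /=.
congr (_ - _); last by rewrite mulmxA.
by rewrite -mulmxA mxtrace_mulC mulmxA.
Qed.

Definition simple_lie : Prop :=
  (exists x y : g, bracket x y <> 0) /\
  forall J : {vspace g}, (forall x y, y \in J -> bracket x y \in J) ->
    J = 0%VS \/ J = fullv.

Definition bracketv (U V : {vspace g}) : {vspace g} :=
  <<[seq bracket x y | x <- vbasis U, y <- vbasis V]>>%VS.

Definition lower_central h (n : nat) : {vspace g} := iter n (bracketv h) h.

Definition cartan_subalgebra h : Prop :=
  [/\ forall x y, x \in h -> y \in h -> bracket x y \in h,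
      exists n, lower_central h n = 0%VS
    & forall x, (forall y, y \in h -> bracket x y \in h) -> x \in h].

Definition hdual h := 'Hom(subvs_of h, F^o).
HB.instance Definition _ h := Vector.on (hdual h).

Section Roots.
Variable h : {vspace g}.
Implicit Types al lam : hdual h.

Definition weight_space al : set g :=
  [set x | forall t : subvs_of h, bracket (vsval t) x = (al t : F) *: x].

Definition is_root al : Prop := al <> 0 /\ exists2 x, weight_space al x & x <> 0.

Definition nneg_combination (D : seq (hdual h)) al : Prop :=
  exists n : nat -> nat, al = \sum_(i < size D) D`_i *+ n i.

Definition is_base (D : seq (hdual h)) : Prop :=
  [/\ basis_of fullv D,
      forall al, al \in D -> is_root al
    & forall al, is_root al -> nneg_combination D al \/ nneg_combination D (- al)].

Definition positive_root D al : Prop := is_root al /\ nneg_combination D al.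

(* The nilradical [n_+], the sum of the positive root spaces. *)
Definition n_plus D : set g :=
  lspan [set x | exists2 al, positive_root D al & weight_space al x]%classic.

Definition highest_weight_vector D lam (M : lieMod g) (v : M) : Prop :=
  [/\ v <> 0,
      forall x, n_plus D x -> lm_act x v = 0
    & forall t : subvs_of h, lm_act (vsval t) v = (lam t : F) *: v].

Definition highest_weight_module D lam (M : lieMod g) : Prop :=
  exists2 v : M, highest_weight_vector D lam v
    & forall W : set M, submodule W -> W v -> forall u, W u.

(* [M] is a copy of [V(lam)], which is unique up to isomorphism. *)
Definition irreducible_highest_weight D lam (M : lieMod g) : Prop :=
  highest_weight_module D lam M /\ irreducible M.

End Roots.
End FinLie.

Section Affine.
Variables (F : fieldType) (g : finLieAlgType F).

Definition loop := fsupp int g.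
HB.instance Definition _ := GRing.Lmodule.on loop.

Definition xt (n : int) (x : g) : loop := fsingle n x.

Lemma regular_scale (c : F) (x : F^o) : c *: x = (c * x : F).
Proof. by []. Qed.

Lemma xt_linear n : linear (xt n).
Proof. exact: fsingle_linear. Qed.

Definition loop_bracket : loop -> loop -> loop :=
  fext2 (fun m n x y => xt (m + n) (bracket x y)).

Definition loop_cocycle : loop -> loop -> F^o :=
  fext2 (W := F^o)
    (fun m n x y => killing x y * m%:~R * (m + n == 0)%:R).

Definition loop_deriv : loop -> loop := fext (fun m x => xt m (m%:~R *: x)).

Lemma loop_bracket_linear_l f' : linear (loop_bracket ^~ f').
Proof.
apply: fext2_linear_l => [m n y|m n x] c u v.
  by rewrite bracket_linear_l xt_linear.
by rewrite bracket_linear_r xt_linear.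
Qed.

Lemma loop_bracket_linear_r f : linear (loop_bracket f).
Proof.
apply: fext2_linear_r => [m n y|m n x] c u v.
  by rewrite bracket_linear_l xt_linear.
by rewrite bracket_linear_r xt_linear.
Qed.

Lemma loop_bracketE m n x y :
  loop_bracket (xt m x) (xt n y) = xt (m + n) (bracket x y).
Proof.
rewrite /loop_bracket fext2E // => [m' n' y'|m' n' x'] c u v.
  by rewrite bracket_linear_l xt_linear.
by rewrite bracket_linear_r xt_linear.
Qed.

Lemma loop_cocycle_linear_l f' : linear (fun f => loop_cocycle f f').
Proof.
apply: fext2_linear_l => [m n y|m n x] c u v.
  by rewrite killing_linear_l !regular_scale !mulrDl !mulrA.
by rewrite killing_linear_r !regular_scale !mulrDl !mulrA.
Qed.

Lemma loop_cocycle_linear_r f : linear (loop_cocycle f).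
Proof.
apply: fext2_linear_r => [m n y|m n x] c u v.
  by rewrite killing_linear_l !regular_scale !mulrDl !mulrA.
by rewrite killing_linear_r !regular_scale !mulrDl !mulrA.
Qed.

Lemma loop_cocycleE m n x y :
  loop_cocycle (xt m x) (xt n y) = killing x y * m%:~R * (m + n == 0)%:R.
Proof.
rewrite /loop_cocycle fext2E // => [m' n' y'|m' n' x'] c u v.
  by rewrite killing_linear_l !regular_scale !mulrDl !mulrA.
by rewrite killing_linear_r !regular_scale !mulrDl !mulrA.
Qed.

Lemma loop_deriv_sub m : linear (fun x => xt m (m%:~R *: x)).
Proof.
move=> c x y.
by rewrite -xt_linear scalerDr !scalerA mulrC.
Qed.

Lemma loop_deriv_linear : linear loop_deriv.
Proof. by apply: fext_linear => m; exact: loop_deriv_sub. Qed.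

Lemma loop_derivE m x : loop_deriv (xt m x) = xt m (m%:~R *: x).
Proof. by rewrite /loop_deriv fext_linE // => i; exact: loop_deriv_sub. Qed.

Lemma loop_ind (P : loop -> Prop) :
  P 0 -> (forall f f', P f -> P f' -> P (f + f')) ->
  (forall n x, P (xt n x)) -> forall f, P f.
Proof. exact: fsupp_ind. Qed.

End Affine.

Lemma add3ACA (V : zmodType) (a b c a' b' c' : V) :
  (a + a') + (b + b') + (c + c') = (a + b + c) + (a' + b' + c').
Proof. by rewrite (addrACA a a' b b') [LHS]addrACA. Qed.

Lemma jacobi_cancel (V : zmodType) (j1 j2 j3 x1 x2 x3 x4 x5 x6 y1 y2 y3 : V) :
  j1 + j2 + j3 = 0 ->
  j1 + x1 - x2 - x5 + x3 + y1 - y2 + j2 + x4 - x3 - x1 + x6 + y3 - y1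
    + j3 + x5 - x6 - x4 + x2 + y2 - y3 = 0.
Proof.
move=> j0; rewrite [LHS](ACl (1*8*15*(2*11)*(19*3)*(16*4)*(5*10)*(6*14)*(20*7)*(9*18)*
  (12*17)*(13*21))) /=.
by rewrite !subrr !addr0.
Qed.

(* Stated for abstract [B], [C], [D] to keep unification from unfolding them.   *)
Section AffineIdentities.
Variables (F : fieldType) (g : finLieAlgType F).
Implicit Types u v w : loop g.
Variables (B : loop g -> loop g -> loop g) (C : loop g -> loop g -> F^o).
Variable D : loop g -> loop g.
Hypothesis Bl : forall w, linear (B ^~ w).
Hypothesis Br : forall w, linear (B w).
Hypothesis Cl : forall w, linear (C ^~ w).
Hypothesis Cr : forall w, linear (C w).
Hypothesis Dd : linear D.
Hypothesis BE : forall m n x y, B (xt m x) (xt n y) = xt (m + n) (bracket x y).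
Hypothesis CE : forall m n x y,
  C (xt m x) (xt n y) = killing x y * m%:~R * (m + n == 0)%:R.
Hypothesis DE : forall m x, D (xt m x) = xt m (m%:~R *: x).

Let B0 w : B 0 w = 0. Proof. exact: (linear_fun0 (Bl w)). Qed.
Let C0 w : C 0 w = 0. Proof. exact: (linear_fun0 (Cl w)). Qed.
Let B0r w : B w 0 = 0. Proof. exact: (linear_fun0 (Br w)). Qed.
Let C0r w : C w 0 = 0. Proof. exact: (linear_fun0 (Cr w)). Qed.
Let BD u v w : B (u + v) w = B u w + B v w.
Proof. exact: (linear_funD (Bl w)). Qed.
Let CD u v w : C (u + v) w = C u w + C v w.
Proof. exact: (linear_funD (Cl w)). Qed.
Let BDr u v w : B w (u + v) = B w u + B w v.
Proof. exact: (linear_funD (Br w)). Qed.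
Let CDr u v w : C w (u + v) = C w u + C w v.
Proof. exact: (linear_funD (Cr w)). Qed.
Let D0 : D 0 = 0. Proof. exact: (linear_fun0 Dd). Qed.
Let DD u v : D (u + v) = D u + D v.
Proof. exact: (linear_funD Dd). Qed.

Lemma loop_bracketC_subproof u v : B u v = - B v u.
Proof.
elim/loop_ind: u => [|u1 u2 IH1 IH2|m x]; first by rewrite B0 B0r oppr0.
  by rewrite BD BDr IH1 IH2 opprD.
elim/loop_ind: v => [|v1 v2 IH1 IH2|n y]; first by rewrite B0 B0r oppr0.
  by rewrite BD BDr IH1 IH2 opprD.
by rewrite !BE bracketC addrC (linear_funN (xt_linear _)).
Qed.

Lemma loop_cocycleC_subproof u v : C u v = - C v u.
Proof.
elim/loop_ind: u => [|u1 u2 IH1 IH2|m x]; first by rewrite C0 C0r oppr0.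
  by rewrite CD CDr IH1 IH2 opprD.
elim/loop_ind: v => [|v1 v2 IH1 IH2|n y]; first by rewrite C0 C0r oppr0.
  by rewrite CD CDr IH1 IH2 opprD.
rewrite !CE killingC [n + m]addrC.
have [/eqP|_] := eqVneq (m + n) 0; last by rewrite !mulr0 oppr0.
by rewrite addr_eq0 => /eqP ->; rewrite mulrNz mulrN mulNr.
Qed.

Lemma loop_bracketxx_subproof u : B u u = 0.
Proof.
elim/loop_ind: u => [|u v IHu IHv|m x]; first exact: B0.
  by rewrite BD !BDr IHu IHv add0r addr0 (loop_bracketC_subproof u) addNr.
by rewrite BE bracketxx (linear_fun0 (xt_linear _)).
Qed.

Lemma loop_cocyclexx_subproof u : C u u = 0.
Proof.
elim/loop_ind: u => [|u v IHu IHv|m x]; first exact: C0.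
  by rewrite CD !CDr IHu IHv add0r addr0 (loop_cocycleC_subproof u) addNr.
rewrite CE -mulr2n mulrn_eq0 /=.
by have [->|_] := eqVneq m 0; rewrite ?mulr0 ?mul0r.
Qed.

Lemma loop_jacobi_subproof u v w :
  B u (B v w) + B v (B w u) +
    B w (B u v) = 0.
Proof.
elim/loop_ind: u => [|u1 u2 IH1 IH2|m x].
- by rewrite !(B0, B0r) !addr0.
- by rewrite !(BD, BDr) add3ACA IH1 IH2 addr0.
elim/loop_ind: v => [|u1 u2 IH1 IH2|n y].
- by rewrite !(B0, B0r) !addr0.
- by rewrite !(BD, BDr) add3ACA IH1 IH2 addr0.
elim/loop_ind: w => [|u1 u2 IH1 IH2|p z].
- by rewrite !(B0, B0r) !addr0.
- by rewrite !(BD, BDr) add3ACA IH1 IH2 addr0.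
rewrite !BE [n + (p + m)]addrCA [p + (m + n)]addrC -!addrA.
rewrite [m + (n + p)]addrA [p + (n + m)]addrC [n + m]addrC -!(linear_funD (xt_linear _)).
by rewrite addrA jacobi (linear_fun0 (xt_linear _)).
Qed.

Lemma loop_cocycle_jacobi_subproof u v w :
  C u (B v w) + C v (B w u) +
    C w (B u v) = 0.
Proof.
elim/loop_ind: u => [|u1 u2 IH1 IH2|m x].
- by rewrite !(B0, B0r, C0, C0r) !addr0.
- by rewrite !(BD, BDr, CD, CDr) add3ACA IH1 IH2 addr0.
elim/loop_ind: v => [|u1 u2 IH1 IH2|n y].
- by rewrite !(B0, B0r, C0, C0r) !addr0.
- by rewrite !(BD, BDr, CD, CDr) add3ACA IH1 IH2 addr0.
elim/loop_ind: w => [|u1 u2 IH1 IH2|p z].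
- by rewrite !(B0, B0r, C0, C0r) !addr0.
- by rewrite !(BD, BDr, CD, CDr) add3ACA IH1 IH2 addr0.
rewrite !BE !CE.
rewrite [n + (p + m)]addrCA [p + (m + n)]addrCA [n + m]addrC [p + (m + n)]addrCA.
have -> : killing y (bracket z x) = killing x (bracket y z).
  by rewrite -killing_invariant killingC.
have -> : killing z (bracket x y) = killing x (bracket y z).
  by rewrite killingC killing_invariant.
rewrite [n + p]addrC.
have [mnp|_] := eqVneq (m + (p + n)) 0; last by rewrite !mulr0 !addr0.
by rewrite !mulr1 -!mulrDr -!intrD -addrA [n + p]addrC mnp mulr0.
Qed.

Lemma loop_deriv_bracket_subproof u v :
  D (B u v) =
    B (D u) v + B u (D v).
Proof.
elim/loop_ind: u => [|u1 u2 IH1 IH2|m x].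
- by rewrite !(B0, B0r, D0) addr0.
- by rewrite !(BD, BDr, DD) IH1 IH2 addrACA.
elim/loop_ind: v => [|u1 u2 IH1 IH2|n y].
- by rewrite !(B0, B0r, D0) addr0.
- by rewrite !(BD, BDr, DD) IH1 IH2 addrACA.
rewrite !(DE, BE) bracketZl bracketZr.
by rewrite -(linear_funD (xt_linear _)) -scalerDl -intrD.
Qed.

Lemma loop_deriv_cocycle_subproof u v :
  C (D u) v + C u (D v) = 0.
Proof.
elim/loop_ind: u => [|u1 u2 IH1 IH2|m x].
- by rewrite !(C0, C0r, D0) addr0.
- by rewrite !(CD, CDr, DD) addrACA IH1 IH2 addr0.
elim/loop_ind: v => [|u1 u2 IH1 IH2|n y].
- by rewrite !(C0, C0r, D0) addr0.
- by rewrite !(CD, CDr, DD) addrACA IH1 IH2 addr0.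
rewrite !(DE, CE).
have [mn|_] := eqVneq (m + n) 0; last by rewrite !mulr0 addr0.
rewrite (linear_funZ (killing_linear_l y)) (linear_funZ (killing_linear_r x)).
rewrite !mulr1 -mulrDl -[LHS]/((m%:~R * killing x y + n%:~R * killing x y) * m%:~R).
by rewrite -mulrDl -intrD mn !mul0r.
Qed.

Lemma affine_jacobi1_subproof f f' f'' (a a' a'' : F) :
  B f (B f' f'' + a' *: D f'' - a'' *: D f')
    + a *: D (B f' f'' + a' *: D f'' - a'' *: D f') - (0 : F) *: D f
  + (B f' (B f'' f + a'' *: D f - a *: D f'')
    + a' *: D (B f'' f + a'' *: D f - a *: D f'') - (0 : F) *: D f')
  + (B f'' (B f f' + a *: D f' - a' *: D f)
    + a'' *: D (B f f' + a *: D f' - a' *: D f) - (0 : F) *: D f'') = 0.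
Proof.
have BC p q : B (D p) q = - B q (D p) by exact: loop_bracketC_subproof.
rewrite !scale0r !subr0.
rewrite !(linear_funB (Br _)) !(linear_funD (Br _)) !(linear_funZ (Br _)).
rewrite !(linear_funB Dd) !(linear_funD Dd) !(linear_funZ Dd).
rewrite !loop_deriv_bracket_subproof !BC !scalerBr !scalerDr !scalerN !scalerA.
rewrite !addrA [a' * a]mulrC [a'' * a]mulrC [a'' * a']mulrC.
apply: jacobi_cancel; exact: loop_jacobi_subproof.
Qed.

Lemma affine_jacobi2_subproof f f' f'' (a a' a'' : F) :
  C f (B f' f'' + a' *: D f'' - a'' *: D f')
  + C f' (B f'' f + a'' *: D f - a *: D f'')
  + C f'' (B f f' + a *: D f' - a' *: D f) = 0.
Proof.
have CDC p q : C q (D p) = C p (D q).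
  have /eqP := loop_deriv_cocycle_subproof p q.
  by rewrite (loop_cocycleC_subproof (D p) q) addrC subr_eq0 => /eqP ->.
rewrite !(linear_funB (Cr _)) !(linear_funD (Cr _)) !(linear_funZ (Cr _)).
rewrite (CDC f f') (CDC f' f'') (CDC f'' f) !addrA.
rewrite [LHS](ACl (1*4*7*(2*9)*(5*3)*(8*6))) /=.
by rewrite !subrr !addr0; exact: loop_cocycle_jacobi_subproof.
Qed.

End AffineIdentities.

Section AffineIdentitiesInst.
Variables (F : fieldType) (g : finLieAlgType F).
Implicit Types u v w : loop g.

Lemma loop_bracketC u v : loop_bracket u v = - loop_bracket v u.
Proof.
exact: (loop_bracketC_subproof (@loop_bracket_linear_l F g)
  (@loop_bracket_linear_r F g) (@loop_bracketE F g)).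
Qed.

Lemma loop_cocycleC u v : loop_cocycle u v = - loop_cocycle v u.
Proof.
exact: (loop_cocycleC_subproof (@loop_cocycle_linear_l F g)
  (@loop_cocycle_linear_r F g) (@loop_cocycleE F g)).
Qed.

Lemma loop_bracketxx u : loop_bracket u u = 0.
Proof.
exact: (loop_bracketxx_subproof (@loop_bracket_linear_l F g)
  (@loop_bracket_linear_r F g) (@loop_bracketE F g)).
Qed.

Lemma loop_cocyclexx u : loop_cocycle u u = 0.
Proof.
exact: (loop_cocyclexx_subproof (@loop_cocycle_linear_l F g)
  (@loop_cocycle_linear_r F g) (@loop_cocycleE F g)).
Qed.

Lemma loop_jacobi u v w :
  loop_bracket u (loop_bracket v w) + loop_bracket v (loop_bracket w u) +
    loop_bracket w (loop_bracket u v) = 0.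
Proof.
exact: (loop_jacobi_subproof (@loop_bracket_linear_l F g)
  (@loop_bracket_linear_r F g) (@loop_bracketE F g)).
Qed.

Lemma loop_cocycle_jacobi u v w :
  loop_cocycle u (loop_bracket v w) + loop_cocycle v (loop_bracket w u) +
    loop_cocycle w (loop_bracket u v) = 0.
Proof.
exact: (loop_cocycle_jacobi_subproof (@loop_bracket_linear_l F g)
  (@loop_bracket_linear_r F g) (@loop_cocycle_linear_l F g)
  (@loop_cocycle_linear_r F g) (@loop_bracketE F g) (@loop_cocycleE F g)).
Qed.

Lemma loop_deriv_bracket u v :
  loop_deriv (loop_bracket u v) =
    loop_bracket (loop_deriv u) v + loop_bracket u (loop_deriv v).
Proof.
exact: (loop_deriv_bracket_subproof (@loop_bracket_linear_l F g)
  (@loop_bracket_linear_r F g) (@loop_deriv_linear F g) (@loop_bracketE F g)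
  (@loop_derivE F g)).
Qed.

Lemma loop_deriv_cocycle u v :
  loop_cocycle (loop_deriv u) v + loop_cocycle u (loop_deriv v) = 0.
Proof.
exact: (loop_deriv_cocycle_subproof (@loop_cocycle_linear_l F g)
  (@loop_cocycle_linear_r F g) (@loop_deriv_linear F g) (@loop_cocycleE F g)
  (@loop_derivE F g)).
Qed.

End AffineIdentitiesInst.

Section AffineAlgebras.
Variables (F : fieldType) (g : finLieAlgType F).

(* [(f, c)] stands for [f + c K]. *)
Definition affine_hat : Type := (loop g * F^o)%type.
HB.instance Definition _ := GRing.Lmodule.on affine_hat.

(* [(f, c, b)] stands for [f + c K + b d]. *)
Definition affine : Type := (loop g * F^o * F^o)%type.
HB.instance Definition _ := GRing.Lmodule.on affine.

Definition hat_bracket (u v : affine_hat) : affine_hat :=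
  (loop_bracket u.1 v.1, loop_cocycle u.1 v.1).

Lemma hat_bracket_linear_l v : linear (hat_bracket ^~ v).
Proof.
by move=> c u w; rewrite /hat_bracket loop_bracket_linear_l loop_cocycle_linear_l.
Qed.

Lemma hat_bracket_linear_r u : linear (hat_bracket u).
Proof.
by move=> c v w; rewrite /hat_bracket loop_bracket_linear_r loop_cocycle_linear_r.
Qed.

Lemma hat_bracketxx u : hat_bracket u u = 0.
Proof. by rewrite /hat_bracket loop_bracketxx loop_cocyclexx. Qed.

Lemma hat_jacobi u v w :
  hat_bracket u (hat_bracket v w) + hat_bracket v (hat_bracket w u) +
    hat_bracket w (hat_bracket u v) = 0.
Proof. by congr pair; [exact: loop_jacobi|exact: loop_cocycle_jacobi]. Qed.

HB.instance Definition _ := isLieAlgebra.Build F affine_hat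
  hat_bracket_linear_l hat_bracket_linear_r hat_bracketxx hat_jacobi.

Definition affine_bracket (u v : affine) : affine :=
  (loop_bracket u.1.1 v.1.1 + (u.2 : F) *: loop_deriv v.1.1
     - (v.2 : F) *: loop_deriv u.1.1,
   loop_cocycle u.1.1 v.1.1, 0).

Lemma affine_bracketC u v : affine_bracket u v = - affine_bracket v u.
Proof.
rewrite /affine_bracket; congr (_, _, _); rewrite ?oppr0 //=.
  by rewrite loop_bracketC opprB opprD addrA [_ *: _ - _]addrC.
exact: loop_cocycleC.
Qed.

Lemma affine_bracket_linear_l v : linear (affine_bracket ^~ v).
Proof.
move=> c u w; congr (_, _, _).
- rewrite /= loop_bracket_linear_l loop_deriv_linear scalerDl scalerDr opprD.
  by rewrite add3ACA scalerBr scalerDr !scalerA [v.2 * c]mulrC.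
- exact: loop_cocycle_linear_l.
- by rewrite /= scaler0 addr0.
Qed.

Lemma affine_bracket_linear_r u : linear (affine_bracket u).
Proof.
move=> c v w; rewrite ![affine_bracket u _]affine_bracketC.
by rewrite affine_bracket_linear_l opprD scalerN.
Qed.

Lemma affine_bracketxx u : affine_bracket u u = 0.
Proof. by rewrite /affine_bracket loop_bracketxx loop_cocyclexx add0r subrr. Qed.

Lemma affine_jacobi u v w :
  affine_bracket u (affine_bracket v w) + affine_bracket v (affine_bracket w u) +
    affine_bracket w (affine_bracket u v) = 0.
Proof.
case: u => [[f cf] a]; case: v => [[f' cf'] a']; case: w => [[f'' cf''] a''].
congr (_, _, _); last by rewrite /= !addr0.
  exact: (affine_jacobi1_subproof (@loop_bracket_linear_l F g)
    (@loop_bracket_linear_r F g) (@loop_deriv_linear F g) (@loop_bracketE F g)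
    (@loop_derivE F g)).
exact: (affine_jacobi2_subproof (@loop_bracket_linear_l F g)
  (@loop_bracket_linear_r F g) (@loop_cocycle_linear_l F g)
  (@loop_cocycle_linear_r F g) (@loop_deriv_linear F g) (@loop_bracketE F g)
  (@loop_cocycleE F g) (@loop_derivE F g)).
Qed.

HB.instance Definition _ := isLieAlgebra.Build F affine
  affine_bracket_linear_l affine_bracket_linear_r affine_bracketxx affine_jacobi.

End AffineAlgebras.

(* Tensor products over [F]: free vector space modulo multilinearity.          *)

Section Tensor.
Variables (F : fieldType) (P M : lmodType F).

Definition tfree := fsupp (P * M)%type F^o.
HB.instance Definition _ := GRing.Lmodule.on tfree.
Definition tgen (p : P) (m : M) : tfree := fsingle (p, m) (1 : F^o).

Definition tensor_rel : set tfree :=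
  [set r | (exists c p p' m,
              r = tgen (c *: p + p') m - (c *: tgen p m + tgen p' m)) \/
           (exists c p m m',
              r = tgen p (c *: m + m') - (c *: tgen p m + tgen p m'))]%classic.

Definition tensor : Type := qmod tensor_rel.
HB.instance Definition _ := GRing.Lmodule.on tensor.

Definition tpure (p : P) (m : M) : tensor := qpi tensor_rel (tgen p m).

Lemma tpure_linear_l m : linear (tpure ^~ m).
Proof.
move=> c p p'; apply/eqP; rewrite -subr_eq0 -linearP -linearB; apply/eqP.
by apply: qpi0; left; exists c, p, p', m.
Qed.

Lemma tpure_linear_r p : linear (tpure p).
Proof.
move=> c m m'; apply/eqP; rewrite -subr_eq0 -linearP -linearB; apply/eqP.
by apply: qpi0; right; exists c, p, m, m'.
Qed.

Section Lift.
Variables (W : lmodType F) (B : P -> M -> W).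

Definition tfree_ext : tfree -> W :=
  fext (fun pm (a : F^o) => (a : F) *: B pm.1 pm.2).

Lemma tfree_ext_linear : linear tfree_ext.
Proof.
by apply: fext_linear => pm c a a'; rewrite scalerDl scalerA.
Qed.

Lemma tfree_extE p m : tfree_ext (tgen p m) = B p m.
Proof.
rewrite /tfree_ext fext_linE ?scale1r // => pm c a a'.
by rewrite scalerDl scalerA.
Qed.

(* The linear map [p (x) m |-> B p m], for a bilinear [B]. *)
Definition tlift : tensor -> W := qlift tfree_ext.

Hypothesis Bl : forall m, linear (B ^~ m).
Hypothesis Br : forall p, linear (B p).

Lemma tfree_ext_rel r : tensor_rel r -> tfree_ext r = 0.
Proof.
have xl := tfree_ext_linear.
case=> [[c [p [p' [m ->]]]]|[c [p [m [m' ->]]]]];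
  rewrite (linear_funB xl) xl !tfree_extE.
  by rewrite Bl subrr.
by rewrite Br subrr.
Qed.

Lemma tliftE p m : tlift (tpure p m) = B p m.
Proof.
by rewrite /tlift /tpure qliftE ?tfree_extE //;
  [exact: tfree_ext_linear|exact: tfree_ext_rel].
Qed.

Lemma tlift_linear : linear tlift.
Proof. by apply: qlift_linear; [exact: tfree_ext_linear|exact: tfree_ext_rel]. Qed.

End Lift.

Lemma tensor_ext (W : lmodType F) (p q : tensor -> W) : linear p -> linear q ->
  (forall x m, p (tpure x m) = q (tpure x m)) -> p =1 q.
Proof.
move=> pl ql pq t; case: (qmodP t) => {t} f.
have Hl (h : tensor -> W) : linear h -> linear (h \o qpi tensor_rel).
  by move=> hl c u v; rewrite /= linearP hl.
apply: (fsupp_lin_ext (Hl _ pl) (Hl _ ql)) => -[x m] a /=.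
have -> : fsingle (x, m) a = (a : F) *: tgen x m.
  by rewrite -(linear_funZ (@fsingle_linear _ _ F^o (x, m))) /GRing.scale /= mulr1.
by rewrite linearZ (linear_funZ pl) (linear_funZ ql); congr (_ *: _); exact: pq.
Qed.

End Tensor.

(* [M1 (x) ... (x) Mn], for a family indexed by a finite type. *)
Section MTensor.
Variables (F : fieldType) (I : finType) (V : I -> lmodType F).

Definition vfam : Type := forall i, V i.
HB.instance Definition _ := gen_eqMixin vfam.
HB.instance Definition _ := gen_choiceMixin vfam.

Definition vset (v : vfam) (i : I) (x : V i) : vfam :=
  @dfwith I (fun i => V i : Type) v i x.

Lemma vset_in v i x : @vset v i x i = x.
Proof. exact: dfwith_in. Qed.

Lemma vset_out v i x j : i != j -> @vset v i x j = v j.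
Proof. exact: dfwith_out. Qed.

Lemma vset_vset v i x y : @vset (@vset v i x) i y = @vset v i y.
Proof.
apply/functional_extensionality_dep => j; have [<-|ij] := eqVneq i j.
  by rewrite !vset_in.
by rewrite !vset_out.
Qed.

Lemma vset_comm v i j x y : i != j ->
  @vset (@vset v i x) j y = @vset (@vset v j y) i x.
Proof.
move=> ij; apply/functional_extensionality_dep => k.
have [<-|ik] := eqVneq i k.
  by rewrite vset_in vset_out ?vset_in // eq_sym.
have [<-|jk] := eqVneq j k; first by rewrite vset_in vset_out ?vset_in.
by rewrite !vset_out.
Qed.

Definition mfree := fsupp vfam F^o.
HB.instance Definition _ := GRing.Lmodule.on mfree.
Definition mgen (v : vfam) : mfree := fsingle v (1 : F^o).

Definition mtensor_rel : set mfree :=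
  [set r | exists v i c x y,
     r = mgen (@vset v i (c *: x + y))
           - (c *: mgen (@vset v i x) + mgen (@vset v i y))]%classic.

Definition mtensor : Type := qmod mtensor_rel.
HB.instance Definition _ := GRing.Lmodule.on mtensor.

Definition mpure (v : vfam) : mtensor := qpi mtensor_rel (mgen v).

Lemma mpure_linear v i : linear (fun x => mpure (@vset v i x)).
Proof.
move=> c x y; apply/eqP; rewrite -subr_eq0 -linearP -linearB; apply/eqP.
by apply: qpi0; exists v, i, c, x, y.
Qed.

Section Lift.
Variables (W : lmodType F) (B : vfam -> W).

Definition mfree_ext : mfree -> W := fext (fun v (a : F^o) => (a : F) *: B v).

Lemma mfree_ext_linear : linear mfree_ext.
Proof. by apply: fext_linear => v c a a'; rewrite scalerDl scalerA. Qed.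

Lemma mfree_extE v : mfree_ext (mgen v) = B v.
Proof.
by rewrite /mfree_ext fext_linE ?scale1r // => u c a a'; rewrite scalerDl scalerA.
Qed.

(* The linear map [v_1 (x) ... (x) v_n |-> B v], for a multilinear [B]. *)
Definition mlift : mtensor -> W := qlift mfree_ext.

Hypothesis Bl : forall v i, linear (fun x => B (@vset v i x)).

Lemma mfree_ext_rel r : mtensor_rel r -> mfree_ext r = 0.
Proof.
case=> [v [i [c [x [y ->]]]]].
rewrite (linear_funB mfree_ext_linear) mfree_ext_linear !mfree_extE.
by rewrite Bl subrr.
Qed.

Lemma mliftE v : mlift (mpure v) = B v.
Proof.
by rewrite /mlift /mpure qliftE ?mfree_extE //;
  [exact: mfree_ext_linear|exact: mfree_ext_rel].
Qed.

Lemma mlift_linear : linear mlift.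
Proof. by apply: qlift_linear; [exact: mfree_ext_linear|exact: mfree_ext_rel]. Qed.

End Lift.

Lemma mtensor_ext (W : lmodType F) (p q : mtensor -> W) : linear p -> linear q ->
  (forall v, p (mpure v) = q (mpure v)) -> p =1 q.
Proof.
move=> pl ql pq t; case: (qmodP t) => {t} f.
have Hl (h : mtensor -> W) : linear h -> linear (h \o qpi mtensor_rel).
  by move=> hl c u v; rewrite /= linearP hl.
apply: (fsupp_lin_ext (Hl _ pl) (Hl _ ql)) => v a /=.
have -> : fsingle v a = (a : F) *: mgen v.
  by rewrite -(linear_funZ (@fsingle_linear _ _ F^o v)) /GRing.scale /= mulr1.
by rewrite linearZ (linear_funZ pl) (linear_funZ ql); congr (_ *: _); exact: pq.
Qed.

(* [1 (x) ... (x) phi (x) ... (x) 1], with [phi] at the [i]-th place. *)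
Definition mact (i : I) (phi : V i -> V i) : mtensor -> mtensor :=
  mlift (fun v => mpure (@vset v i (phi (v i)))).

Section Act.
Variables (i : I) (phi : V i -> V i).
Hypothesis phil : linear phi.

Lemma mact_multilinear v j :
  linear (fun x => mpure (@vset (@vset v j x) i (phi (@vset v j x i)))).
Proof.
move=> c x y; have [ij|ij] := eqVneq j i.
  by case: i / ij phi phil => psi psil; rewrite !vset_vset !vset_in psil mpure_linear.
by rewrite !(@vset_out v j _ i) // !(@vset_comm v j i) // mpure_linear.
Qed.

Lemma mact_linear : linear (mact phi).
Proof. exact: mlift_linear mact_multilinear. Qed.

Lemma mactE v : mact phi (mpure v) = mpure (@vset v i (phi (v i))).
Proof. exact: (mliftE mact_multilinear). Qed.

End Act.

Lemma mact_comm i j (phi : V i -> V i) (psi : V j -> V j) t :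
  linear phi -> linear psi -> i != j ->
  mact phi (mact psi t) = mact psi (mact phi t).
Proof.
move=> phil psil ij; move: t; apply: mtensor_ext => [c u v|c u v|v].
- by rewrite !mact_linear.
- by rewrite !mact_linear.
by rewrite !mactE // !vset_out // 1?eq_sym // vset_comm // eq_sym.
Qed.

Lemma mactM i (phi psi : V i -> V i) t : linear phi -> linear psi ->
  mact phi (mact psi t) = mact (phi \o psi) t.
Proof.
move=> phil psil; have cl : linear (phi \o psi).
  by move=> c u v; rewrite /= psil phil.
move: t; apply: mtensor_ext => [c u v|c u v|v]; rewrite ?mact_linear //.
by rewrite !mactE // vset_in vset_vset.
Qed.

Lemma mact_combo i (phi psi chi : V i -> V i) c t :
  linear phi -> linear psi -> (forall v, chi v = c *: phi v + psi v) ->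
  mact chi t = c *: mact phi t + mact psi t.
Proof.
move=> phil psil chiE; have cl : linear chi.
  move=> d u v; rewrite !chiE phil psil !scalerDr !scalerA [c * d]mulrC.
  by rewrite addrACA.
move: t; apply: mtensor_ext => [d u v|d u v|v]; rewrite ?mact_linear //.
  by rewrite !scalerDr !scalerA [c * d]mulrC addrACA.
by rewrite !mactE // chiE mpure_linear.
Qed.

End MTensor.

Section TensorModule.
Variables (F : fieldType) (g : lieAlgType F) (M N : lieMod g).

Definition tensor_act (x : g) : tensor M N -> tensor M N :=
  tlift (fun (m : M) (n : N) => tpure (lm_act x m) n + tpure m (lm_act x n)).

Lemma tensor_act_sub_l x (n : N) :
  linear (fun m : M => tpure (lm_act x m) n + tpure m (lm_act x n)).
Proof.
by move=> c m m'; rewrite lm_act_linear_r !tpure_linear_l scalerDr addrACA.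
Qed.

Lemma tensor_act_sub_r x (m : M) :
  linear (fun n : N => tpure (lm_act x m) n + tpure m (lm_act x n)).
Proof.
by move=> c n n'; rewrite lm_act_linear_r !tpure_linear_r scalerDr addrACA.
Qed.

Lemma tensor_actE x (m : M) (n : N) :
  tensor_act x (tpure m n) = tpure (lm_act x m) n + tpure m (lm_act x n).
Proof. exact: (tliftE (@tensor_act_sub_l x) (@tensor_act_sub_r x)). Qed.

Lemma tensor_act_linear_r x : linear (tensor_act x).
Proof. exact: (tlift_linear (@tensor_act_sub_l x) (@tensor_act_sub_r x)). Qed.

Lemma tensor_act_linear_l t : linear (tensor_act ^~ t).
Proof.
move=> c x y; move: t.
apply: (@tensor_ext _ _ _ _ _ (fun t => c *: tensor_act x t + tensor_act y t)).
- exact: tensor_act_linear_r.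
- move=> d u v; rewrite !tensor_act_linear_r !scalerDr !scalerA [c * d]mulrC.
  by rewrite addrACA.
move=> m n; rewrite !tensor_actE !lm_act_linear_l tpure_linear_l tpure_linear_r.
by rewrite scalerDr addrACA.
Qed.

Lemma tensor_act_bracket x y t :
  tensor_act (bracket x y) t =
    tensor_act x (tensor_act y t) - tensor_act y (tensor_act x t).
Proof.
move: t; apply: (@tensor_ext _ _ _ _ _ (fun t =>
  tensor_act x (tensor_act y t) - tensor_act y (tensor_act x t))).
- exact: tensor_act_linear_r.
- by move=> c u v; rewrite !tensor_act_linear_r scalerBr opprD addrACA.
move=> m n; rewrite !tensor_actE !(linear_funD (tensor_act_linear_r _)).
rewrite !tensor_actE !lm_act_bracket.
rewrite (linear_funB (@tpure_linear_l _ _ _ _)) (linear_funB (@tpure_linear_r _ _ _ _)).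
move: (tpure (lm_act x (lm_act y m)) n) (tpure (lm_act y (lm_act x m)) n) => p q.
move: (tpure m (lm_act x (lm_act y n))) (tpure m (lm_act y (lm_act x n))) => p' q'.
move: (tpure (lm_act y m) (lm_act x n)) (tpure (lm_act x m) (lm_act y n)) => r s.
rewrite !opprD !addrA [RHS](ACl (1*5*4*8*(2*7)*(3*6))) /=.
by rewrite !subrr !addr0.
Qed.

Definition tensor_mod : lieMod g :=
  LieMod tensor_act_linear_l tensor_act_linear_r tensor_act_bracket.

End TensorModule.

Section EvalModule.
Variables (F : fieldType) (g : finLieAlgType F) (I : finType).
Variables (V : I -> lieMod g) (a : I -> F).

Let T := mtensor (fun i => V i : lmodType F).

Definition site_act (x : g) (i : I) : T -> T :=
  @mact F I (fun i => V i : lmodType F) i (lm_act x).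

Definition xt_act (t : T) (k : int) (x : g) : T :=
  \sum_i a i ^ k *: site_act x i t.

(* [u.2], the coefficient of [K], acts as [0]. *)
Definition eval_act (u : affine_hat g) (t : T) : T := fext (xt_act t) u.1.

Lemma site_act_linear_r x i : linear (site_act x i).
Proof. exact: mact_linear (lm_act_linear_r x). Qed.

Lemma site_act_linear_l i t : linear (fun x => site_act x i t).
Proof.
move=> c x y; apply: mact_combo => [||v]; try exact: lm_act_linear_r.
exact: lm_act_linear_l.
Qed.

Lemma xt_act_linear_l t k : linear (xt_act t k).
Proof.
move=> c x y; rewrite /xt_act scaler_sumr -big_split; apply: eq_bigr => i _ /=.
by rewrite site_act_linear_l scalerDr !scalerA mulrC.
Qed.

Lemma xt_act_linear_r k x : linear (fun t => xt_act t k x).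
Proof.
move=> c s t; rewrite /xt_act scaler_sumr -big_split; apply: eq_bigr => i _ /=.
by rewrite site_act_linear_r scalerDr !scalerA mulrC.
Qed.

Lemma eval_actE k x c t : eval_act (xt k x, c) t = xt_act t k x.
Proof. by rewrite /eval_act fext_linE // => j; exact: xt_act_linear_l. Qed.

Lemma eval_act_linear_l t : linear (eval_act ^~ t).
Proof.
by move=> c u v; rewrite /eval_act /= fext_linear // => k; exact: xt_act_linear_l.
Qed.

Lemma eval_act_linear_r u : linear (eval_act u).
Proof.
move=> c s t; rewrite /eval_act.
apply: (@fext_combo _ _ _ _ (xt_act s) (xt_act t)) => [k|k|k x].
- exact: xt_act_linear_l.
- exact: xt_act_linear_l.
- exact: xt_act_linear_r.
Qed.

Lemma site_act_bracket x y i t :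
  site_act (bracket x y) i t =
    site_act x i (site_act y i t) - site_act y i (site_act x i t).
Proof.
rewrite /site_act !mactM; try exact: lm_act_linear_r.
rewrite addrC -scaleN1r; apply: mact_combo => [c u v|c u v|v] /=.
- by rewrite !lm_act_linear_r.
- by rewrite !lm_act_linear_r.
by rewrite scaleN1r addrC lm_act_bracket.
Qed.

Lemma site_act_comm x y i j t : i != j ->
  site_act x i (site_act y j t) = site_act y j (site_act x i t).
Proof. by move=> ij; apply: mact_comm => //; exact: lm_act_linear_r. Qed.

Hypothesis a_neq0 : forall i, a i != 0.

Lemma xt_act_bracket t k l x y :
  xt_act t (k + l) (bracket x y) =
    xt_act (xt_act t l y) k x - xt_act (xt_act t k x) l y.
Proof.
have E k' l' x' y' : xt_act (xt_act t l' y') k' x' =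
    \sum_i \sum_j (a i ^ k' * a j ^ l') *: site_act x' i (site_act y' j t).
  apply: eq_bigr => i _; rewrite /xt_act.
  pose L := HB.pack (site_act x' i) (GRing.isLinear.Build _ _ _ _ _ (@site_act_linear_r x' i)) : {linear T -> T}.
  rewrite -[site_act x' i _]/(L _) (linear_sum L) scaler_sumr.
  by apply: eq_bigr => j _; rewrite (@linear_funZ _ T T L (@site_act_linear_r x' i)) scalerA.
rewrite !E [X in _ - X]exchange_big -sumrB; apply: eq_bigr => i _ /=.
rewrite -sumrB (bigD1 i) //= big1 ?addr0 => [|j ji].
  by rewrite [a i ^ l * _]mulrC -scalerBr -site_act_bracket expfzDr.
by rewrite site_act_comm 1?eq_sym // [a j ^ l * _]mulrC subrr.
Qed.

Lemma eval_act_bracket_subproof (E : loop g -> T -> T) (B : loop g -> loop g -> loop g) :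
  (forall t, linear (E ^~ t)) -> (forall f, linear (E f)) ->
  (forall f, linear (B ^~ f)) -> (forall f, linear (B f)) ->
  (forall k x t, E (xt k x) t = xt_act t k x) ->
  (forall m n x y, B (xt m x) (xt n y) = xt (m + n) (bracket x y)) ->
  forall f f' t, E (B f f') t = E f (E f' t) - E f' (E f t).
Proof.
move=> El Er Bl Br EE BE f f' t.
elim/loop_ind: f => [|f1 f2 IH1 IH2|k x].
- rewrite (linear_fun0 (Bl _)) !(linear_fun0 (El _)) (linear_fun0 (Er _)).
  by rewrite subrr.
- rewrite (linear_funD (Bl _)) !(linear_funD (El _)) (linear_funD (Er _)) IH1 IH2.
  by rewrite opprD addrACA.
elim/loop_ind: f' => [|f1 f2 IH1 IH2|l y].
- rewrite (linear_fun0 (Br _)) !(linear_fun0 (El _)) (linear_fun0 (Er _)).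
  by rewrite subrr.
- rewrite (linear_funD (Br _)) !(linear_funD (El _)) (linear_funD (Er _)) IH1 IH2.
  by rewrite opprD addrACA.
by rewrite BE !EE xt_act_bracket.
Qed.

Lemma eval_act_bracket u v t :
  eval_act (bracket u v) t =
    eval_act u (eval_act v t) - eval_act v (eval_act u t).
Proof.
apply: (@eval_act_bracket_subproof (fun h w => fext (xt_act w) h)
  (@loop_bracket F g)) => [w|h|w|h|k x w|].
- by apply: fext_linear => k; exact: xt_act_linear_l.
- exact: (eval_act_linear_r (h, 0)).
- exact: loop_bracket_linear_l.
- exact: loop_bracket_linear_r.
- exact: (eval_actE k x 0).
- exact: loop_bracketE.
Qed.

Definition eval_mod : lieMod (affine_hat g) :=
  LieMod eval_act_linear_l eval_act_linear_r eval_act_bracket.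

End EvalModule.

(* The universal enveloping algebra: the free associative algebra on the set   *)
(* [g] modulo [c x + y] = c [x] + [y] and [x][y] - [y][x] = [[x, y]].           *)

Section FreeAlgebra.
Variables (F : fieldType) (X : choiceType).

Definition freealg := fsupp (seq X) F^o.
HB.instance Definition _ := GRing.Lmodule.on freealg.

Definition fword (w : seq X) (c : F^o) : freealg := fsingle w c.
Definition fone : freealg := fword [::] 1.
Definition fmul : freealg -> freealg -> freealg :=
  fext2 (fun w w' (c c' : F^o) => fword (w ++ w') ((c : F) * c' : F^o)).

Lemma fmul_sub_l (w w' : seq X) (c' : F^o) :
  linear (fun c : F^o => fword (w ++ w') ((c : F) * c' : F^o)).
Proof. by move=> d c c''; rewrite -fsingle_linear /GRing.scale /= mulrDl mulrA. Qed.

Lemma fmul_sub_r (w w' : seq X) (c : F^o) :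
  linear (fun c' : F^o => fword (w ++ w') ((c : F) * c' : F^o)).
Proof.
by move=> d c' c''; rewrite -fsingle_linear /GRing.scale /= mulrDr mulrCA.
Qed.

Lemma fmul_linear_l q : linear (fmul ^~ q).
Proof. exact: fext2_linear_l fmul_sub_l fmul_sub_r q. Qed.

Lemma fmul_linear_r p : linear (fmul p).
Proof. exact: fext2_linear_r fmul_sub_l fmul_sub_r p. Qed.

Lemma fmulE w w' c c' : fmul (fword w c) (fword w' c') = fword (w ++ w') ((c : F) * c').
Proof. exact: fext2E fmul_sub_l fmul_sub_r w w' c c'. Qed.

Lemma fmulA_subproof (m : freealg -> freealg -> freealg) :
  (forall q, linear (m ^~ q)) -> (forall p, linear (m p)) ->
  (forall w w' c c', m (fword w c) (fword w' c') = fword (w ++ w') ((c : F) * c')) ->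
  associative m.
Proof.
move=> ml mr mE p q r.
have m0l s : m 0 s = 0 by exact: (linear_fun0 (ml s)).
have m0r s : m s 0 = 0 by exact: (linear_fun0 (mr s)).
have mDl s s' s'' : m (s + s') s'' = m s s'' + m s' s'' by exact: (linear_funD (ml _)).
have mDr s s' s'' : m s'' (s + s') = m s'' s + m s'' s' by exact: (linear_funD (mr _)).
elim/fsupp_ind: p => [|p p' IH IH'|w c]; first by rewrite !m0l.
  by rewrite !mDl IH IH'.
elim/fsupp_ind: q => [|p p' IH IH'|w' c']; first by rewrite !(m0l, m0r).
  by rewrite !(mDl, mDr) IH IH'.
elim/fsupp_ind: r => [|p p' IH IH'|w'' c'']; first by rewrite !m0r.
  by rewrite !mDr IH IH'.
by rewrite -!/(fword _ _) !mE catA mulrA.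
Qed.

Lemma fmulA : associative fmul.
Proof. exact: fmulA_subproof fmul_linear_l fmul_linear_r fmulE. Qed.

Lemma fmul1r : left_id fone fmul.
Proof.
apply: (fsupp_lin_ext (fmul_linear_r fone)) => // w c.
by rewrite -!/(fword _ _) fmulE mul1r.
Qed.

Lemma fmulr1 : right_id fone fmul.
Proof.
apply: (fsupp_lin_ext (fmul_linear_l fone)) => // w c.
by rewrite -!/(fword _ _) fmulE cats0 mulr1.
Qed.

Lemma fmulDl : left_distributive fmul +%R.
Proof. by move=> p q r; exact: (linear_funD (fmul_linear_l r)). Qed.

Lemma fmulDr : right_distributive fmul +%R.
Proof. by move=> p q r; exact: (linear_funD (fmul_linear_r p)). Qed.

HB.instance Definition _ := GRing.Zmodule_isPzRing.Build freealg
  fmulA fmul1r fmulr1 fmulDl fmulDr.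

Lemma fmulZl c (p q : freealg) : (c *: p) * q = c *: (p * q).
Proof. exact: (linear_funZ (fmul_linear_l q)). Qed.

Lemma fmulZr c (p q : freealg) : p * (c *: q) = c *: (p * q).
Proof. exact: (linear_funZ (fmul_linear_r p)). Qed.

Definition fgen (x : X) : freealg := fword [:: x] 1.

End FreeAlgebra.

Section Enveloping.
Variables (F : fieldType) (g : lieAlgType F).
Local Notation fgen := (@fgen F g).

Definition env_gen : set (freealg F g) :=
  [set s | (exists c x y, s = fgen (c *: x + y) - (c *: fgen x + fgen y)) \/
           (exists x y, s = fgen x * fgen y - fgen y * fgen x - fgen (bracket x y))]%classic.

(* [lspan env_rel] is the two-sided ideal generated by [env_gen]. *)
Definition env_rel : set (freealg F g) :=
  [set r | exists p s q, env_gen s /\ r = p * s * q]%classic.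

Definition env : Type := qmod env_rel.
HB.instance Definition _ := GRing.Lmodule.on env.

Local Notation pi := (qpi env_rel).

Lemma env_idealr p q : lspan env_rel p -> lspan env_rel (p * q).
Proof.
elim=> [|c u v [a [s [b [gs ->]]]] _ IH]; first by rewrite mul0r; exact: lspan0.
rewrite mulrDl fmulZl -mulrA; apply: lspan_step => //.
by exists a, s, (b * q).
Qed.

Lemma env_ideall p q : lspan env_rel q -> lspan env_rel (p * q).
Proof.
elim=> [|c u v [a [s [b [gs ->]]]] _ IH]; first by rewrite mulr0; exact: lspan0.
rewrite mulrDr fmulZr !mulrA; apply: lspan_step => //.
by exists (p * a), s, b.
Qed.

Definition env_one : env := pi 1.
Definition env_mul (a b : env) : env := pi (qrepr a * qrepr b).

Lemma env_mulE p q : env_mul (pi p) (pi q) = pi (p * q).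
Proof.
apply/qpi_eq.
rewrite (_ : _ - _ = (qrepr (pi p) - p) * qrepr (pi q) + p * (qrepr (pi q) - q)).
  apply: lspanD; [apply: env_idealr|apply: env_ideall];
  by apply/qpi_eq; exact: qreprK.
by rewrite mulrBl mulrBr addrA subrK.
Qed.

Lemma env_mulA : associative env_mul.
Proof.
move=> a b c; case: (qmodP a) => p; case: (qmodP b) => q; case: (qmodP c) => r.
by rewrite !env_mulE mulrA.
Qed.

Lemma env_mul1r : left_id env_one env_mul.
Proof. by move=> a; case: (qmodP a) => p; rewrite env_mulE mul1r. Qed.

Lemma env_mulr1 : right_id env_one env_mul.
Proof. by move=> a; case: (qmodP a) => p; rewrite env_mulE mulr1. Qed.

Lemma env_mulDl : left_distributive env_mul +%R.
Proof.
move=> a b c; case: (qmodP a) => p; case: (qmodP b) => q; case: (qmodP c) => r.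
by rewrite -linearD !env_mulE mulrDl linearD.
Qed.

Lemma env_mulDr : right_distributive env_mul +%R.
Proof.
move=> a b c; case: (qmodP a) => p; case: (qmodP b) => q; case: (qmodP c) => r.
by rewrite -linearD !env_mulE mulrDr linearD.
Qed.

HB.instance Definition _ := GRing.Zmodule_isPzRing.Build env
  env_mulA env_mul1r env_mulr1 env_mulDl env_mulDr.

Lemma env_piM p q : pi (p * q) = (pi p : env) * pi q.
Proof. by rewrite -env_mulE. Qed.

Lemma env_mulZl c (a b : env) : (c *: a) * b = c *: (a * b).
Proof.
case: (qmodP a) => p; case: (qmodP b) => q.
by rewrite -linearZ -!env_piM fmulZl linearZ.
Qed.

Lemma env_mulZr c (a b : env) : a * (c *: b) = c *: (a * b).
Proof.
case: (qmodP a) => p; case: (qmodP b) => q.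
by rewrite -linearZ -!env_piM fmulZr linearZ.
Qed.

Definition env_inj (x : g) : env := pi (fgen x).

Lemma env_rel_gen s : env_gen s -> env_rel s.
Proof. by move=> gs; exists 1, s, 1; rewrite mul1r mulr1. Qed.

Lemma env_inj_linear : linear env_inj.
Proof.
move=> c x y; apply/eqP; rewrite -subr_eq0 -linearP -linearB; apply/eqP.
by apply/qpi0/env_rel_gen; left; exists c, x, y.
Qed.

Lemma env_inj_bracket x y :
  env_inj (bracket x y) = env_inj x * env_inj y - env_inj y * env_inj x.
Proof.
apply/esym/eqP; rewrite -subr_eq0 -!env_piM -!linearB; apply/eqP.
by apply/qpi0/env_rel_gen; right; exists x, y.
Qed.

Section EnvAct.
Variable M : lieMod g.

Definition free_act (p : freealg F g) (v : M) : M :=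
  fext (fun w (c : F^o) => (c : F) *: foldr (@lm_act F g M) v w) p.

Definition env_act (a : env) (v : M) : M := qlift (free_act ^~ v) a.

Lemma free_act_sub v w : linear (fun c : F^o => (c : F) *: foldr (@lm_act F g M) v w).
Proof. by move=> d c c'; rewrite scalerDl scalerA. Qed.

Lemma foldr_act_linear w : linear (fun v => foldr (@lm_act F g M) v w).
Proof. by elim: w => //= x w IH c u v; rewrite IH lm_act_linear_r. Qed.

Lemma free_act_linear_l v : linear (free_act ^~ v).
Proof. by apply: fext_linear => w; exact: free_act_sub. Qed.

Lemma free_actE w c v : free_act (fword w c) v = (c : F) *: foldr (@lm_act F g M) v w.
Proof. by rewrite /free_act /fword fext_linE // => w'; exact: free_act_sub. Qed.

Lemma free_act_linear_r p : linear (free_act p).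
Proof.
move=> c u v; rewrite /free_act.
apply: (@fext_combo _ _ _ _ (fun w (a : F^o) => (a : F) *: foldr (@lm_act F g M) u w)
  (fun w (a : F^o) => (a : F) *: foldr (@lm_act F g M) v w)) => [w|w|w a].
- exact: free_act_sub.
- exact: free_act_sub.
by rewrite foldr_act_linear scalerDr !scalerA mulrC.
Qed.

Lemma free_actM_subproof (A : freealg F g -> M -> M)
    (m : freealg F g -> freealg F g -> freealg F g) :
  (forall v, linear (A ^~ v)) -> (forall p, linear (A p)) ->
  (forall q, linear (m ^~ q)) -> (forall p, linear (m p)) ->
  (forall w c v, A (fword w c) v = (c : F) *: foldr (@lm_act F g M) v w) ->
  (forall w w' c c', m (fword w c) (fword w' c') = fword (w ++ w') ((c : F) * c')) ->
  forall p q v, A (m p q) v = A p (A q v).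
Proof.
move=> Al Ar ml mr AE mE p q v.
elim/fsupp_ind: p => [|p p' IH IH'|w c].
- by rewrite (linear_fun0 (ml _)) !(linear_fun0 (Al _)).
- by rewrite (linear_funD (ml _)) !(linear_funD (Al _)) IH IH'.
elim/fsupp_ind: q => [|p p' IH IH'|w' c'].
- by rewrite (linear_fun0 (mr _)) !(linear_fun0 (Al _)) (linear_fun0 (Ar _)).
- by rewrite (linear_funD (mr _)) !(linear_funD (Al _)) (linear_funD (Ar _)) IH IH'.
rewrite -!/(fword _ _) mE !AE foldr_cat (linear_funZ (foldr_act_linear w)).
by rewrite scalerA.
Qed.

Lemma free_actM p q v : free_act (p * q) v = free_act p (free_act q v).
Proof.
exact: (free_actM_subproof free_act_linear_l free_act_linear_r
  (@fmul_linear_l _ _) (@fmul_linear_r _ _) free_actE (@fmulE _ _)).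
Qed.

Lemma free_act_gen x v : free_act (fgen x) v = lm_act x v.
Proof. by rewrite /fgen free_actE scale1r. Qed.

Lemma free_act_rel v r : env_rel r -> free_act r v = 0.
Proof.
case=> p [s [q [gs ->]]]; rewrite !free_actM.
suff -> u : free_act s u = 0 by exact: (linear_fun0 (free_act_linear_r p)).
have Al := free_act_linear_l u.
case: gs => [[c [x [y ->]]]|[x [y ->]]].
  by rewrite (linear_funB Al) Al !free_act_gen lm_act_linear_l subrr.
rewrite !(linear_funB Al) !free_actM !free_act_gen lm_act_bracket.
exact: subrr.
Qed.

Lemma env_actE p v : env_act (pi p) v = free_act p v.
Proof. exact: (qliftE _ (free_act_linear_l v) (@free_act_rel v)). Qed.

Lemma env_act_linear_l v : linear (env_act ^~ v).
Proof. exact: qlift_linear (free_act_linear_l v) (@free_act_rel v). Qed.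

Lemma env_act_linear_r a : linear (env_act a).
Proof.
case: (qmodP a) => p c u v; rewrite !env_actE; exact: free_act_linear_r.
Qed.

Lemma env_act1 v : env_act 1 v = v.
Proof. by rewrite env_actE free_actE scale1r. Qed.

Lemma env_actM a b v : env_act (a * b) v = env_act a (env_act b v).
Proof.
case: (qmodP a) => p; case: (qmodP b) => q.
by rewrite -env_piM !env_actE free_actM.
Qed.

Lemma env_act_inj x v : env_act (env_inj x) v = lm_act x v.
Proof. by rewrite env_actE free_act_gen. Qed.

End EnvAct.
End Enveloping.

Section EnvMap.
Variables (F : fieldType) (g g' : lieAlgType F) (phi : g -> g').

Definition free_map : freealg F g -> freealg F g' :=
  fext (fun w (c : F^o) => fword (map phi w) c).

(* The map [U(g) -> U(g')] induced by a homomorphism [phi]. *)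
Definition env_map (a : env g) : env g' :=
  qlift (fun p => qpi (@env_rel F g') (free_map p) : env g') a.

Lemma free_map_linear : linear free_map.
Proof. by apply: fext_linear => w; exact: fsingle_linear. Qed.

Lemma free_mapE w c : free_map (fword w c) = fword (map phi w) c.
Proof. by rewrite /free_map /fword fext_linE // => w'; exact: fsingle_linear. Qed.

Lemma free_mapM_subproof (f : freealg F g -> freealg F g')
    (m : freealg F g -> freealg F g -> freealg F g)
    (m' : freealg F g' -> freealg F g' -> freealg F g') :
  linear f -> (forall q, linear (m ^~ q)) -> (forall p, linear (m p)) ->
  (forall q, linear (m' ^~ q)) -> (forall p, linear (m' p)) ->
  (forall w c, f (fword w c) = fword (map phi w) c) ->
  (forall w w' c c', m (fword w c) (fword w' c') = fword (w ++ w') ((c : F) * c')) ->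
  (forall w w' c c', m' (fword w c) (fword w' c') = fword (w ++ w') ((c : F) * c')) ->
  forall p q, f (m p q) = m' (f p) (f q).
Proof.
move=> fl ml mr ml' mr' fE mE mE' p q.
elim/fsupp_ind: p => [|p p' IH IH'|w c].
- by rewrite (linear_fun0 (ml _)) !(linear_fun0 fl) (linear_fun0 (ml' _)).
- by rewrite (linear_funD (ml _)) !(linear_funD fl) (linear_funD (ml' _)) IH IH'.
elim/fsupp_ind: q => [|p p' IH IH'|w' c'].
- by rewrite (linear_fun0 (mr _)) !(linear_fun0 fl) (linear_fun0 (mr' _)).
- by rewrite (linear_funD (mr _)) !(linear_funD fl) (linear_funD (mr' _)) IH IH'.
by rewrite -!/(fword _ _) mE !fE mE' map_cat.
Qed.

Lemma free_mapM p q : free_map (p * q) = free_map p * free_map q.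
Proof.
exact: (free_mapM_subproof free_map_linear (@fmul_linear_l _ _)
  (@fmul_linear_r _ _) (@fmul_linear_l _ _) (@fmul_linear_r _ _) free_mapE
  (@fmulE _ _) (@fmulE _ _)).
Qed.

Hypothesis phi_linear : linear phi.
Hypothesis phi_bracket : forall x y, phi (bracket x y) = bracket (phi x) (phi y).

Lemma free_map_rel r : env_rel r -> qpi (@env_rel F g') (free_map r) = 0.
Proof.
case=> p [s [q [gs ->]]]; rewrite !free_mapM; apply: qpi0.
exists (free_map p), (free_map s), (free_map q); split=> //.
have fl := free_map_linear.
case: gs => [[c [x [y ->]]]|[x [y ->]]]; [left; exists c, (phi x), (phi y)|
  right; exists (phi x), (phi y)].
  by rewrite (linear_funB fl) fl !free_mapE /= phi_linear.
by rewrite !(linear_funB fl) !free_mapM !free_mapE /= phi_bracket.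
Qed.

Lemma env_mapE p : env_map (qpi (@env_rel F g) p) = qpi (@env_rel F g') (free_map p).
Proof.
apply: qliftE; last exact: free_map_rel.
by move=> c u v; rewrite free_map_linear linearP.
Qed.

Lemma env_map_inj x : env_map (env_inj x) = env_inj (phi x).
Proof. by rewrite env_mapE free_mapE. Qed.

Lemma env_mapM a b : env_map (a * b) = env_map a * env_map b.
Proof.
case: (qmodP a) => p; case: (qmodP b) => q.
by rewrite -env_piM !env_mapE free_mapM env_piM.
Qed.

Lemma env_map1 : env_map 1 = 1.
Proof. by rewrite env_mapE free_mapE. Qed.

Lemma env_map_linear : linear env_map.
Proof.
move=> c a b; case: (qmodP a) => p; case: (qmodP b) => q.
by rewrite -linearP !env_mapE free_map_linear linearP.
Qed.

End EnvMap.

(* [P (x)_A M], where [ract] is the right action of [A] on [P] and [lact] is   *)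
(* its left action on [M].                                                     *)
Section TensorOver.
Variables (F : fieldType) (A : Type) (P M : lmodType F).
Variables (ract : P -> A -> P) (lact : A -> M -> M).

Definition balanced_rel : set (tensor P M) :=
  [set r | exists p a m, r = tpure (ract p a) m - tpure p (lact a m)]%classic.

Definition tensor_over : Type := qmod balanced_rel.
HB.instance Definition _ := GRing.Lmodule.on tensor_over.

End TensorOver.

Section Induced.
Variables (F : fieldType) (g g' : lieAlgType F) (phi : g -> g') (M : lieMod g).

(* [U(g') (x)_U(g) M], where [U(g)] acts on [U(g')] through [phi]. *)
Definition ind_space : Type :=
  tensor_over (fun (u : env g') (a : env g) => u * env_map phi a) (@env_act F g M).
HB.instance Definition _ := GRing.Lmodule.on ind_space.

Local Notation rel := (@balanced_rel F (env g) (env g') M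
  (fun u a => u * env_map phi a) (@env_act F g M)).

Definition ind_pure (u : env g') (m : M) : ind_space := qpi rel (tpure u m).

(* Left multiplication by [x] in [g'] on the first factor. *)
Definition ind_act (x : g') : ind_space -> ind_space :=
  qlift (tlift (fun (u : env g') (m : M) => ind_pure (env_inj x * u) m)).

Lemma ind_pure_linear_l m : linear (ind_pure ^~ m).
Proof. by move=> c u v; rewrite /ind_pure tpure_linear_l linearP. Qed.

Lemma ind_pure_linear_r u : linear (ind_pure u).
Proof. by move=> c m n; rewrite /ind_pure tpure_linear_r linearP. Qed.

Lemma ind_pure_balanced u a m :
  ind_pure (u * env_map phi a) m = ind_pure u (env_act a m).
Proof.
apply/eqP; rewrite -subr_eq0 -linearB; apply/eqP.
by apply: qpi0; exists u, a, m.
Qed.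

Lemma ind_act_sub_l x m : linear (fun u => ind_pure (env_inj x * u) m).
Proof.
by move=> c u v; rewrite mulrDr env_mulZr ind_pure_linear_l.
Qed.

Let Bl x := @ind_act_sub_l x.
Let Br x := fun u => @ind_pure_linear_r (env_inj x * u).

Lemma ind_act_rel x r : rel r ->
  tlift (fun (u : env g') (m : M) => ind_pure (env_inj x * u) m) r = 0.
Proof.
case=> u [a [m ->]]; rewrite (linear_funB (tlift_linear (Bl x) (Br x))).
by rewrite !(tliftE (Bl x) (Br x)) mulrA ind_pure_balanced subrr.
Qed.

Lemma ind_actE x u m : ind_act x (ind_pure u m) = ind_pure (env_inj x * u) m.
Proof.
rewrite /ind_act qliftE; first exact: (tliftE (Bl x) (Br x)).
  exact: tlift_linear (Bl x) (Br x).
exact: ind_act_rel.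
Qed.

Lemma ind_act_linear_r x : linear (ind_act x).
Proof. exact: qlift_linear (tlift_linear (Bl x) (Br x)) (@ind_act_rel x). Qed.

Lemma ind_ext (W : lmodType F) (p q : ind_space -> W) : linear p -> linear q ->
  (forall u m, p (ind_pure u m) = q (ind_pure u m)) -> p =1 q.
Proof.
move=> pl ql pq t; case: (qmodP t) => {}t; move: t.
by apply: tensor_ext => [c u v|c u v|]; rewrite ?linearP ?pl ?ql.
Qed.

Lemma ind_act_linear_l t : linear (ind_act ^~ t).
Proof.
move=> c x y; move: t.
apply: (@ind_ext _ _ (fun t => c *: ind_act x t + ind_act y t)).
- exact: ind_act_linear_r.
- move=> d u v; rewrite !ind_act_linear_r !scalerDr !scalerA [c * d]mulrC.
  by rewrite addrACA.
move=> u m; rewrite !ind_actE env_inj_linear mulrDl env_mulZl.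
exact: ind_pure_linear_l.
Qed.

Lemma ind_act_bracket x y t :
  ind_act (bracket x y) t = ind_act x (ind_act y t) - ind_act y (ind_act x t).
Proof.
move: t; apply: (@ind_ext _ _ (fun t =>
  ind_act x (ind_act y t) - ind_act y (ind_act x t))).
- exact: ind_act_linear_r.
- by move=> c u v; rewrite !ind_act_linear_r scalerBr opprD addrACA.
move=> u m; rewrite !ind_actE env_inj_bracket mulrBl -!mulrA.
exact: (linear_funB (@ind_pure_linear_l m)).
Qed.

Definition Ind : lieMod g' :=
  LieMod ind_act_linear_l ind_act_linear_r ind_act_bracket.

End Induced.

Section AffineInduction.
Variables (F : fieldType) (g : finLieAlgType F).

Definition hat_incl (u : affine_hat g) : affine g := (u.1, u.2, 0).

Lemma hat_incl_linear : linear hat_incl.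
Proof. move=> c u v; congr (_, _, _).
by change (0 = c *: (0 : F^o) + 0); rewrite scaler0 addr0. Qed.

Lemma hat_incl_bracket u v :
  hat_incl (bracket u v) = bracket (hat_incl u) (hat_incl v).
Proof.
by congr (_, _, _); rewrite /= !scale0r subr0 addr0.
Qed.

Definition ind_d (M : lieMod (affine_hat g)) : lieMod (affine g) := Ind hat_incl M.

(* [g (x) t^k F[t]] *)
Definition tail_loops (k : nat) : set (loop g) :=
  [set f | forall n : int, n < k%:Z -> f n = 0]%classic.

End AffineInduction.

(* Main.v *)
From Stdlib Require List.
From HB Require Import structures.
Require Import Defs.
From mathcomp Require Import all_boot all_order all_algebra.
From mathcomp Require Import boolp classical_sets functions cardinality.
From mathcomp Require Import reals ereal lebesgue_measure complex.

(* Write E = V_1 (x) ... (x) V_m.  Every V_i has countable dimension, so an    *)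
(* endomorphism of it is a scalar (C is uncountable) and the density theorem   *)
(* applies.  Hence a nonzero subspace of E (x) L stable under g acting at each *)
(* site and under the affine algebra acting on L contains a pure tensor, and   *)
(* is everything.  For large k, x (x) t^k kills a given vector of L and acts   *)
(* on E (x) L as sum_i a_i^k x^(i), with x^(i) the action at the i-th site; a  *)
(* Vandermonde argument isolates each x^(i), so E (x) L is irreducible.        *)
(* In M[d] = sum_j d^j (x) M one has                                           *)
(* (x (x) t^k) (d^j (x) v) = (d - k)^j (x) (x (x) t^k) v, so for v_0, ..., v_n *)
(* in M and large k, x (x) t^k sends sum_j d^j (x) v_j to                      *)
(* sum_i a_i^k sum_j (d - k)^j (x) x^(i) v_j.  The functions k |-> a_i^k k^s   *)
(* being independent, a submodule containing that vector contains every        *)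
(* 1 (x) x^(i) v_n.  If v_n is nonzero, these are not all zero, because E (x) L *)
(* has no site invariants when some lambda_i is nonzero.                       *)

Set Implicit Arguments.
Unset Strict Implicit.
Unset Printing Implicit Defensive.

Import Order.TTheory GRing.Theory Num.Theory.
Local Open Scope ring_scope.
Local Open Scope complex_scope.

(** One tool serves twice. By [exp_poly_extract], a subspace that contains, for all large k, the sum
    over i and j <= n of a_i^k (D - k)^j y_ij contains each top coefficient y_in; sampling at large
    k thus separates the sites.

    For n = 0 it makes a submodule of E (x) L stable under every site action, hence also under the
    affine algebra acting on L alone, and [outer_tensor_irreducible] applies. The density argument
    behind that lemma needs scalar endomorphisms of each V_i, which [irreducible_schur] supplies.

    For general n it is applied in M[d], whose vectors are sums of d^j (x) s_j by [ind_d_sum]: a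
    submodule containing such a sum contains 1 (x) x^(i) s_n, and by [site_invariants] one of these
    is nonzero if s_n is. Irreducibility of M then fills the submodule. That M[d] is nonzero is
    [ind_d_pure1_inj], through a map to a module of functions [int -> M]. *)

(** * Linear algebra in arbitrary dimension *)

Section Subspaces.
Variables (F : fieldType) (V : lmodType F).

Definition subspace (N : set V) : Prop :=
  N 0 /\ forall c u v, N u -> N v -> N (c *: u + v).

Variable N : set V.
Hypothesis subN : subspace N.

Lemma subspaceD u v : N u -> N v -> N (u + v).
Proof. by move=> Nu Nv; rewrite -[u]scale1r; exact: subN.2. Qed.

Lemma subspaceZ c u : N u -> N (c *: u).
Proof. by move=> Nu; rewrite -[_ *: _]addr0; apply: subN.2 => //; exact: subN.1. Qed.

Lemma subspaceB u v : N u -> N v -> N (u - v).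
Proof. by move=> Nu Nv; rewrite addrC -scaleN1r; exact: subN.2. Qed.

Lemma subspace_sum (J : Type) (r : seq J) (P : pred J) (G : J -> V) :
  (forall j, P j -> N (G j)) -> N (\sum_(j <- r | P j) G j).
Proof.
move=> NG; elim/big_rec: _ => [|j u Pj Nu]; first exact: subN.1.
by apply: subspaceD => //; exact: NG.
Qed.

Lemma subspace_unscale c u : c != 0 -> N (c *: u) -> N u.
Proof. by move=> c0 /(subspaceZ c^-1); rewrite scalerA mulVf // scale1r. Qed.

End Subspaces.

Section LinearFunctions.
Variables (F : fieldType) (V W : lmodType F).

Lemma linear_fun_sum (f : V -> W) (J : Type) (r : seq J) (P : pred J) (G : J -> V) :
  linear f -> f (\sum_(j <- r | P j) G j) = \sum_(j <- r | P j) f (G j).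
Proof.
move=> fl.
exact: (linear_sum (HB.pack f (GRing.isLinear.Build _ _ _ _ _ fl) : {linear V -> W})).
Qed.

(* The hypothesis [ext] compares the zero map with the quotient by the span of *)
(* the range of [gen].                                                        *)
Lemma spanned_of_ext (U : Type) (gen : U -> V) :
  (forall p q : V -> qmod (fun v => lspan (range gen) v), linear p -> linear q ->
     (forall u, p (gen u) = q (gen u)) -> p =1 q) ->
  forall N : set V, subspace N -> (forall u, N (gen u)) -> forall v, N v.
Proof.
move=> ext N subN Ngen v.
have /qpi_eq : qpi (fun v => lspan (range gen) v) v = qpi _ 0.
  rewrite [RHS]linear0; apply: (ext (qpi _) (fun=> 0)) => [||u].
  - exact: qpi_linear.
  - by move=> c x y; rewrite scaler0 addr0.
  - by apply: qpi0; apply: lspan_in; exists u.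
rewrite subr0; elim=> [|c x y Nx _ Ny]; first exact: subN.1.
apply: subN.2 => //; elim: Nx => [|d s t [u _ <-] _ Nt]; first exact: subN.1.
by apply: subN.2.
Qed.

End LinearFunctions.

(** By Zorn, a subspace maximal among those avoiding v is a complement of the line through v; f
    reads off the coordinate along v. *)
Lemma linear_functional (F : fieldType) (V : lmodType F) (v : V) : v <> 0 ->
  exists2 f : V -> F^o, linear f & f v = 1.
Proof.
move=> v0.
(* Membership of 0 is not part of [P], so that the empty union satisfies [P]; maximality restores it
   in [A0]. *)
pose P : set (set V) := [set A | (forall c u w, A u -> A w -> A (c *: u + w)) /\ ~ A v]%classic.
have [|A [[Alin nAv] Amax]] := @Zorn_bigcup V P.
  move=> G GP tot; split=> [c u w [A GA Au] [B GB Bw]|[A /GP[_ +] Av]]; last exact.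
  have [AB|BA] := tot _ _ GA GB; [exists B|exists A] => //.
    by apply: (GP _ GB).1 => //; exact: AB.
  by apply: (GP _ GA).1 => //; exact: BA.
have A0 : A 0.
  apply: contrapT => nA0; apply: (Amax (A `|` [set 0])%classic).
    by split=> [x Ax|sub]; [left|apply: nA0; apply: sub; right].
  have nA x : ~ A x by move=> Ax; apply: nA0; rewrite -(subrr x) addrC -scaleN1r; exact: Alin.
  split=> [c u w [/nA//|/= ->] [/nA//|/= ->]|[//|/= v00]]; last exact: v0.
  by right; rewrite /= scaler0 addr0.
have sA : subspace A by split.
have dec x : exists c, A (x - c *: v).
  (* [B] is the sum of A and the line through x; being strictly larger than A, it contains v. *)
  pose B := [set y | exists c, A (y - c *: x)]%classic.
  have [Ax|nAx] := pselect (A x); first by exists 0; rewrite scale0r subr0.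
  have : B v.
    apply: contrapT => nBv; apply: (Amax B).
      split=> [y Ay|]; first by exists 0; rewrite scale0r subr0.
      by move=> sub; apply: nAx; apply: sub; exists 1; rewrite scale1r subrr.
    split=> // c u w [d du] [e ew]; exists (c * d + e).
    rewrite (_ : _ - _ = c *: (u - d *: x) + (w - e *: x)); first exact: Alin.
    by rewrite scalerDl scalerBr scalerA opprD addrACA.
  move=> [c Ac]; have [c0|c0] := eqVneq c 0.
    by move: Ac; rewrite c0 scale0r subr0.
  exists c^-1; rewrite (_ : _ - _ = (- c^-1) *: (v - c *: x)); first exact: subspaceZ.
  by rewrite scalerBr scalerA mulNr mulVf // !scaleNr scale1r opprK addrC.
have [f fP] := choice dec.
have uniq x c d : A (x - c *: v) -> A (x - d *: v) -> c = d.
  move=> Ac Ad; apply/eqP; rewrite -subr_eq0; apply/eqP; apply: contrapT => /eqP cd.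
  apply: nAv; apply: (subspace_unscale sA cd).
  rewrite (_ : _ *: _ = (x - d *: v) - (x - c *: v)); first exact: subspaceB.
  by rewrite opprB [RHS]addrC addrA subrK scalerBl.
exists f => [c x y|].
  apply: (uniq (c *: x + y)); first exact: fP.
  rewrite (_ : _ - _ = c *: (x - f x *: v) + (y - f y *: v)); first exact: Alin.
  by rewrite regular_scale scalerDl scalerBr scalerA opprD addrACA.
by apply: (uniq v); [exact: fP|rewrite scale1r subrr].
Qed.

Section PolyAction.
Variables (F : fieldType) (V : lmodType F) (D : V -> V).

Definition poly_act (p : {poly F}) (y : V) : V := \sum_(i < size p) p`_i *: iter i D y.

Lemma poly_act_wide n (p : {poly F}) y : (size p <= n)%N ->
  poly_act p y = \sum_(i < n) p`_i *: iter i D y.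
Proof.
move=> pn; rewrite /poly_act (big_ord_widen n (fun i => p`_i *: iter i D y)) //.
rewrite big_mkcond; apply: eq_bigr => i _ /=; case: ltnP => // ?.
by rewrite nth_default // scale0r.
Qed.

Lemma poly_act_linear_l y : linear (poly_act ^~ y).
Proof.
move=> c p q; pose n := maxn (size p) (size q).
have cn : (size (c *: p + q)%R <= n)%N.
  by rewrite (leq_trans (size_polyD _ _)) // geq_max leq_maxr andbT
    (leq_trans (size_scale_leq _ _)) // leq_maxl.
rewrite !(@poly_act_wide n) ?leq_maxl ?leq_maxr // scaler_sumr -big_split.
by apply: eq_bigr => i _ /=; rewrite coefD coefZ scalerDl scalerA.
Qed.

Lemma poly_actC c y : poly_act c%:P y = c *: y.
Proof.
by rewrite (@poly_act_wide 1) ?size_polyC_leq1 // big_ord1 coefC.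
Qed.

Hypothesis Dl : linear D.

Lemma poly_act_linear_r p : linear (poly_act p).
Proof.
have il i : linear (iter i D).
  by elim: i => // i IH c u v; rewrite !iterS IH Dl.
move=> c u v; rewrite scaler_sumr -big_split; apply: eq_bigr => i _ /=.
by rewrite il scalerDr !scalerA mulrC.
Qed.

Lemma poly_actMX p y : poly_act (p * 'X) y = D (poly_act p y).
Proof.
rewrite (@poly_act_wide (size p).+1) ?(leq_trans (size_polyMleq _ _)) ?size_polyX ?addn2 //.
rewrite big_ord_recl coefMX scale0r add0r (linear_fun_sum _ _ _ Dl).
by apply: eq_bigr => i _; rewrite coefMX /= (linear_funZ Dl).
Qed.

Lemma poly_actM p q y : poly_act (p * q) y = poly_act p (poly_act q y).
Proof.
elim/poly_ind: p => [|p c IH].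
  by rewrite mul0r !(linear_fun0 (poly_act_linear_l _)).
rewrite mulrDl !(linear_funD (poly_act_linear_l _)) -mulrA ['X * q]mulrC mulrA.
by rewrite !poly_actMX IH poly_actC mul_polyC (linear_funZ (poly_act_linear_l _)).
Qed.

Lemma poly_actX y : poly_act 'X y = D y.
Proof. by rewrite -[X in poly_act X]mul1r poly_actMX poly_actC scale1r. Qed.

Lemma poly_act1 y : poly_act 1 y = y.
Proof. by rewrite poly_actC scale1r. Qed.

Lemma poly_actXsubC c y : poly_act ('X - c%:P) y = D y - c *: y.
Proof. by rewrite (linear_funB (poly_act_linear_l _)) poly_actX poly_actC. Qed.

End PolyAction.

Section GradedSums.
Variables (F : fieldType) (V W : lmodType F) (e : nat -> W -> V).
Hypothesis el : forall j, linear (e j).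

(** Serves both for the span of a sequence, with [e j c] a multiple of its j-th term, and for M[d],
    with [e j m] standing for d^j (x) m. *)
Definition graded_sum n (s : nat -> W) : V := \sum_(j < n) e j (s j).

Lemma graded_sums_subspace :
  subspace (fun v => exists n s, v = graded_sum n s).
Proof.
have widen n m s : (n <= m)%N ->
    graded_sum n s = graded_sum m (fun j => if (j < n)%N then s j else 0).
  move=> nm; rewrite /graded_sum (big_ord_widen m (fun j => e j (s j))) // big_mkcond.
  by apply: eq_bigr => j _; case: ifP; rewrite ?(linear_fun0 (el j)).
split=> [|c _ _ [n [s ->]] [m [r ->]]].
  by exists 0, (fun=> 0); rewrite /graded_sum big_ord0.
rewrite (widen n (n + m)%N) ?leq_addr // (widen m (n + m)%N) ?leq_addl //.
exists (n + m)%N.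
exists (fun j => c *: (if (j < n)%N then s j else 0) + (if (j < m)%N then r j else 0)).
by rewrite /graded_sum scaler_sumr -big_split; apply: eq_bigr => j _; rewrite el.
Qed.

Lemma graded_sum_single j w : exists n s, e j w = graded_sum n s.
Proof.
exists j.+1, (fun k => if k == j then w else 0).
rewrite /graded_sum big_ord_recr /= eqxx big1 ?add0r // => k _.
by rewrite ltn_eqF // (linear_fun0 (el k)).
Qed.

End GradedSums.

(** * Exponential polynomials in [k] *)

Section Shift.
Variable F : fieldType.
Implicit Types (p : {poly F}) (a b : F).

(* Applying [u |-> (k |-> u (k + 1) - b u k)] to [k |-> a ^ k p(X - k)] yields *)
(* [k |-> a ^ k (shift_poly a b p)(X - k)].                                    *)
Definition shift_poly a b p : {poly F} := a *: (p \Po ('X - 1)) - b *: p.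

Lemma size_comp_XsubC p c : size (p \Po ('X - c%:P)) = size p.
Proof. by rewrite size_comp_poly2 // size_XsubC. Qed.

Lemma size_shift_poly n a b p : (size p <= n)%N -> (size (shift_poly a b p) <= n)%N.
Proof.
move=> pn; rewrite (leq_trans (size_polyD _ _)) // size_polyN geq_max.
by rewrite !(leq_trans (size_scale_leq _ _)) // size_comp_XsubC.
Qed.

Lemma coef_XsubC1_exp n : (('X - 1 : {poly F}) ^+ n.+1)`_n = - n.+1%:R.
Proof.
elim: n => [|n IH]; first by rewrite expr1 coefB coefX coef1 sub0r.
rewrite exprS mulrBl mul1r coefB coefXM /= IH.
have /monicP := monic_exp n.+1 (monicXsubC (1 : F)).
by rewrite lead_coefE size_exp_XsubC /= => ->; rewrite -opprD natr1.
Qed.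

Lemma coef_comp_XsubC1_wide n m p : (size p <= n)%N ->
  (p \Po ('X - 1))`_m = \sum_(i < n) p`_i * (('X - 1) ^+ i)`_m.
Proof.
move=> pn; rewrite coef_comp_poly.
rewrite (big_ord_widen n (fun i => p`_i * (('X - 1) ^+ i)`_m)) //.
rewrite big_mkcond; apply: eq_bigr => i _ /=; case: ltnP => // ?.
by rewrite nth_default // mul0r.
Qed.

Lemma coef_comp_XsubC1 n p : (size p <= n.+2)%N ->
  (p \Po ('X - 1))`_n = p`_n - n.+1%:R * p`_n.+1.
Proof.
move=> pn; rewrite (coef_comp_XsubC1_wide _ pn) !big_ord_recr /= big1 ?add0r.
  rewrite coef_XsubC1_exp; have /monicP := monic_exp n (monicXsubC (1 : F)).
  by rewrite lead_coefE size_exp_XsubC /= => ->; rewrite mulr1 mulrN mulrC.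
move=> i _; rewrite [X in _ * X]nth_default ?mulr0 //.
by rewrite size_exp_XsubC.
Qed.

Lemma coef_shift_poly n a b p : (size p <= n.+1)%N ->
  (shift_poly a b p)`_n = (a - b) * p`_n.
Proof.
move=> pn; rewrite coefB !coefZ coef_comp_XsubC1 ?(leq_trans pn) //.
by rewrite [p`_n.+1]nth_default // mulr0 subr0 mulrBl.
Qed.

(** For b = a the shift is a times the backward difference p(X - 1) - p, whose leading term is that
    of -p'. *)
Lemma coef_shift_poly_diag n a p : (size p <= n.+2)%N ->
  (shift_poly a a p)`_n = (- (a * n.+1%:R)) * p`_n.+1.
Proof.
move=> pn; rewrite coefB !coefZ coef_comp_XsubC1 // mulrBr addrAC subrr add0r.
by rewrite mulrA mulNr.
Qed.

Lemma size_shift_poly_diag n a p : (size p <= n.+1)%N ->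
  (size (shift_poly a a p) <= n)%N.
Proof.
move=> pn; apply/leq_sizeP => j; rewrite leq_eqVlt => /predU1P[<-|nj].
  by rewrite coef_shift_poly // subrr mul0r.
have /leq_sizeP := size_shift_poly a a pn; exact.
Qed.

Definition shift_polys a (bs : seq F) p := foldl (fun q b => shift_poly a b q) p bs.

(** Leading terms cancel exactly when b = a, so each occurrence of a in [bs] lowers the degree; the
    other factors never raise it. *)
Lemma size_shift_polys n a bs p : (size p <= n)%N ->
  (size (shift_polys a bs p) <= n - count_mem a bs)%N.
Proof.
elim: bs n p => [|b bs IH] n p pn /=; first by rewrite subn0.
have [->|ba] := eqVneq b a; last exact/IH/size_shift_poly.
case: n pn => [|n] pn; first exact/(IH 0)/size_shift_poly.
by rewrite add1n subSS; exact/IH/size_shift_poly_diag.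
Qed.

Lemma coef_shift_polys n a bs p : (size p <= n.+1)%N ->
  (shift_polys a bs p)`_n = (\prod_(b <- bs) (a - b)) * p`_n.
Proof.
elim: bs p => [|b bs IH] p pn /=; first by rewrite big_nil mul1r.
by rewrite IH ?size_shift_poly // coef_shift_poly // big_cons mulrCA mulrA.
Qed.

Lemma coef_shift_polys_diag n a p : (size p <= n.+1)%N ->
  (shift_polys a (nseq n a) p)`_0 = (\prod_(k < n) (- (a * k.+1%:R))) * p`_n.
Proof.
elim: n p => [|n IH] p pn /=; first by rewrite big_ord0 mul1r.
by rewrite IH ?size_shift_poly_diag // coef_shift_poly_diag // mulrA big_ord_recr.
Qed.

Lemma shift_polys_top n a bs p : (size p <= n.+1)%N ->
  shift_polys a (bs ++ nseq n a) p =
    ((\prod_(k < n) (- (a * k.+1%:R))) * (\prod_(b <- bs) (a - b)) * p`_n)%:P.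
Proof.
move=> pn; rewrite /shift_polys foldl_cat -!/(shift_polys _ _ _).
have sn : (size (shift_polys a bs p) <= n.+1)%N.
  by rewrite (leq_trans (size_shift_polys a bs pn)) // leq_subr.
have := size_shift_polys a (nseq n a) sn.
rewrite count_nseq /= eqxx mul1n subSnn => /size1_polyC ->.
by rewrite coef_shift_polys_diag // coef_shift_polys // mulrA.
Qed.

End Shift.

Section LeadingCoefficients.
Variables (F : fieldType) (V : lmodType F).

Definition shift_seqs (bs : seq F) (u : nat -> V) : nat -> V :=
  foldl (fun u b k => u k.+1 - b *: u k) u bs.

Lemma shift_seqs_subspace (N : set V) bs u k0 : subspace N ->
  (forall k, (k0 <= k)%N -> N (u k)) ->
  forall k, (k0 <= k)%N -> N (shift_seqs bs u k).
Proof.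
move=> subN; elim: bs u => [|b bs IH] u Nu //=; apply: IH => k kk.
by apply: subspaceB => //; [apply: Nu; exact: leqW|apply: subspaceZ => //; exact: Nu].
Qed.

Lemma eq_shift_seqs bs u v : u =1 v -> shift_seqs bs u =1 shift_seqs bs v.
Proof. by move=> /funext ->. Qed.

Lemma shift_seqs_sum (J : Type) (r : seq J) bs (u : J -> nat -> V) k :
  shift_seqs bs (fun k => \sum_(j <- r) u j k) k = \sum_(j <- r) shift_seqs bs (u j) k.
Proof.
elim: bs u k => [|b bs IH] u k //=; rewrite -IH.
apply: eq_shift_seqs => l; rewrite scaler_sumr -sumrB.
exact: eq_bigr.
Qed.

Variables (D : V -> V).

(** This is a^k p(D - k) y; with p = X^j it is the shape in which x (x) t^k acts on d^j (x) v for
    large k. *)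
Definition exp_poly a (p : {poly F}) (y : V) (k : nat) : V :=
  a ^+ k *: poly_act D (p \Po ('X - k%:R%:P)) y.

Lemma exp_poly_shift a b p y k :
  exp_poly a p y k.+1 - b *: exp_poly a p y k = exp_poly a (shift_poly a b p) y k.
Proof.
rewrite /exp_poly /shift_poly comp_polyB !comp_polyZ -comp_polyA.
rewrite (_ : ('X - 1) \Po _ = 'X - k.+1%:R%:P); last first.
  by rewrite comp_polyB comp_polyX comp_polyC -addrA -opprD -polyCD natr1.
rewrite (linear_funB (@poly_act_linear_l _ _ D y)) !(linear_funZ (@poly_act_linear_l _ _ D y)).
by rewrite scalerBr !scalerA exprSr [b * _]mulrC.
Qed.

Lemma shift_seqs_exp_poly a bs p y :
  shift_seqs bs (exp_poly a p y) =1 exp_poly a (shift_polys a bs p) y.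
Proof.
elim: bs p => [|b bs IH] p //= k; rewrite -IH.
by apply: eq_shift_seqs => l; rewrite exp_poly_shift.
Qed.

Hypothesis char0 : [pchar F] =i pred0.

(* The operators [u |-> (k |-> u (k + 1) - a_i' u k)] for [i' != i], each taken *)
(* [n + 1] times, kill the terms of index [i'], and [n] times the one for [i]   *)
(* leaves a nonzero multiple of the top coefficient.                            *)
Lemma exp_poly_extract (I : finType) (a : I -> F) n (N : set V) k0
    (y : I -> 'I_n.+1 -> V) :
  injective a -> (forall i, a i != 0) -> subspace N ->
  (forall k, (k0 <= k)%N ->
     N (\sum_i \sum_(j < n.+1) a i ^+ k *: poly_act D (('X - k%:R%:P) ^+ j) (y i j))) ->
  forall i, N (y i ord_max).
Proof.
move=> ainj a0 subN Nu i0.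
pose cs := [seq b <- codom a | b != a i0].
pose bs := flatten (nseq n.+1 cs) ++ nseq n (a i0).
pose u k := \sum_i \sum_(j < n.+1) exp_poly (a i) 'X^j (y i j) k.
have {}Nu k : (k0 <= k)%N -> N (u k).
  move=> /Nu; congr N; apply: eq_bigr => i _; apply: eq_bigr => j _.
  by rewrite /exp_poly comp_Xn_poly.
have := shift_seqs_subspace bs subN Nu (leqnn k0).
rewrite shift_seqs_sum (bigD1 i0) //= big1 ?addr0 => [|i ii0]; last first.
  rewrite shift_seqs_sum big1 // => j _; rewrite shift_seqs_exp_poly /exp_poly.
  suff -> : shift_polys (a i) bs 'X^j = 0.
    by rewrite comp_poly0 (linear_fun0 (@poly_act_linear_l _ _ D _)) scaler0.
  apply/eqP; rewrite -size_poly_leq0.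
  apply: leq_trans (size_shift_polys _ _ (leqnn _)) _.
  rewrite size_polyXn leqn0 subn_eq0 count_cat count_flatten map_nseq sumn_nseq.
  rewrite (leq_trans (ltn_ord j)) // -[leqLHS]mul1n (leq_trans _ (leq_addr _ _)) //.
  rewrite leq_mul2r /= -has_count has_pred1 mem_filter codom_f andbT.
  by apply: contra_neq ii0 => /ainj.
rewrite shift_seqs_sum (bigD1 ord_max) //= big1 ?addr0 => [|j jn]; last first.
  rewrite shift_seqs_exp_poly /exp_poly shift_polys_top ?size_polyXn //.
  have /negPf nj : n != j by move: jn; rewrite -(inj_eq val_inj) eq_sym.
  rewrite coefXn nj mulr0 polyC0 comp_poly0.
  by rewrite (linear_fun0 (@poly_act_linear_l _ _ D _)) scaler0.
rewrite shift_seqs_exp_poly /exp_poly shift_polys_top ?size_polyXn // coefXn eqxx mulr1.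
rewrite comp_polyC poly_actC scalerA; apply: subspace_unscale => //.
(* The scalar is a power of a_i times factors -(a_i k) with 0 < k <= n, nonzero in characteristic 0,
   and differences a_i - b, nonzero because [cs] omits a_i. *)
rewrite !mulf_neq0 ?expf_neq0 //.
  apply/prodf_neq0 => k _; rewrite oppr_eq0 mulf_neq0 //.
  by move/pcharf0P: char0 => ->.
rewrite prodf_seq_neq0; apply/allP => b /flattenP[s /nseqP[-> _]].
by rewrite mem_filter subr_eq0 eq_sym => /andP[].
Qed.

End LeadingCoefficients.

(** * Scalar endomorphisms and density *)

(** A countable set has Lebesgue measure 0, but the unit interval has measure 1. *)
Lemma real_uncountable (R : realType) : ~ countable [set: R].
Proof.
move=> cR; have c01 : countable (`[0, 1]%classic : set R).
  exact: sub_countable (subset_card_le (@subsetT _ _)) cR.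
have := countable_lebesgue_measure0 c01.
rewrite lebesgue_measure_itv /= lte_fin ltr01 oppr0 adde0 => /eqP.
by rewrite eqe oner_eq0.
Qed.

Lemma complex_uncountable (R : realType) : ~ countable [set: complex R].
Proof.
move=> /countable_injP[f finj]; apply: (@real_uncountable R).
apply/countable_injP; exists (f \o real_complex R) => x y _ _ /= fxy.
by apply: complexI; apply: finj; rewrite ?in_setT.
Qed.

(* The vectors [(phi - c)^-1 v] with [c] in [F] are uncountably many, so some  *)
(* nontrivial linear combination of them vanishes; clearing denominators, a    *)
(* nonzero polynomial in [phi] kills [v].                                      *)
Lemma countable_scalar (F : closedFieldType) (V : lmodType F) (e : nat -> V)
    (phi : V -> V) (v : V) :
  ~ countable [set: F] -> linear phi -> v <> 0 ->
  (forall y, exists n (c : 'I_n -> F), y = \sum_(l < n) c l *: e l) ->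
  (forall c, (forall y, phi y = c *: y) \/
     ((forall y, phi y = c *: y -> y = 0) /\ forall y, exists u, phi u - c *: u = y)) ->
  exists c, forall y, phi y = c *: y.
Proof.
move=> Fbig phil v0 span dich; apply: contrapT => /forallNP nscal.
have inj c y : phi y - c *: y = 0 -> y = 0.
  have [/nscal//|[+ _] /eqP] := dich c.
  by rewrite subr_eq0 => + /eqP; exact.
have surj c : exists u, phi u - c *: u = v.
  by have [/nscal//|[_]] := dich c; exact.
have [u uP] := choice surj.
have [N NP] := choice (fun c => span (u c)).
(* Pigeonhole: if every fibre of N were finite, F would be a countable union of finite sets. Any n +
   1 of the vectors [u c] in one fibre lie in the span of n vectors and are dependent. *)
have [n ninf] : exists n, infinite_set [set c | N c = n].
  apply: contrapT => /forallNP nfin; apply: Fbig.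
  rewrite (_ : setT = \bigcup_n [set c | N c = n])%classic; last first.
    by apply/seteqP; split=> // c _; exists (N c).
  apply: bigcup_countable => // n _; apply: finite_set_countable.
  exact: contrapT (nfin n).
have [B BN Bn] := infinite_set_fset n.+1 ninf.
pose r (j : 'I_n.+1) := nth 0 (finmap.enum_fset B) j.
have rB j : N (r j) = n by apply: BN => /=; apply: mem_nth; exact: leq_trans Bn.
have rinj : injective r.
  move=> i j /eqP; rewrite nth_uniq ?finmap.fset_uniq //; first by move=> /eqP/val_inj.
  - exact: leq_trans Bn.
  - exact: leq_trans Bn.
have /choice[A AP] j : exists c : 'I_n -> F, u (r j) = \sum_(l < n) c l *: e l.
  by have := NP (r j); rewrite rB.
pose M := \matrix_(j, l) A j l.
have : kermx M != 0.
  rewrite -mxrank_eq0 mxrank_ker subn_eq0 -ltnNge ltnS.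
  exact: rank_leq_col.
move=> /rowV0Pn[b /sub_kermxP bM b0].
have bu : \sum_j b 0 j *: u (r j) = 0.
  under eq_bigr do rewrite AP scaler_sumr.
  rewrite exchange_big big1 // => l _.
  under eq_bigr do rewrite scalerA.
  rewrite -scaler_suml (_ : \sum_i _ = 0) ?scale0r //.
  have /matrixP/(_ 0 l) := bM; rewrite !mxE => Ml; rewrite -[RHS]Ml.
  by apply: eq_bigr => j _; rewrite mxE.
(* Multiplying the dependency by the product of all X - r_k turns it into P(phi) v = 0. At r_j every
   term of P but the j-th vanishes, so P is nonzero. *)
pose Q j := \prod_(k | k != j) ('X - (r k)%:P).
pose P := \sum_j b 0 j *: Q j.
have ql := poly_act_linear_l phi; have qr := poly_act_linear_r phil.
have Pv : poly_act phi P v = 0.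
  rewrite (linear_fun_sum _ _ _ (ql v)).
  have := linear_fun0 (qr (\prod_k ('X - (r k)%:P))).
  rewrite -[X in poly_act _ _ X]bu (linear_fun_sum _ _ _ (qr _)) => q0; rewrite -[RHS]q0.
  apply: eq_bigr => j _; rewrite (linear_funZ (ql v)) (linear_funZ (qr _)).
  by rewrite (bigD1 j) //= mulrC poly_actM // poly_actXsubC // uP.
have P0 : P != 0.
  have [j bj] : exists j, b 0 j != 0 by have /rV0Pn := b0.
  apply: contra_neq bj => P0; have : P.[r j] = 0 by rewrite P0 horner0.
  rewrite horner_sum (bigD1 j) //= big1 ?addr0 => [|k kj]; last first.
    rewrite hornerZ horner_prod (bigD1 j) 1?eq_sym //= hornerXsubC subrr.
    by rewrite mul0r mulr0.
  rewrite hornerZ horner_prod => /eqP; rewrite mulf_eq0 => /orP[/eqP //|].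
  move=> /prodf_eq0[k kj]; rewrite hornerXsubC subr_eq0 => /eqP /rinj jk.
  by rewrite jk eqxx in kj.
(* P splits into linear factors, and each phi - x is injective, so P(phi) v = 0 forces v = 0. *)
apply: v0; move: Pv; have [rs ->] := closed_field_poly_normal P.
rewrite (linear_funZ (ql v)) => /eqP; rewrite scaler_eq0 lead_coef_eq0 (negPf P0) /=.
move=> /eqP; elim: rs => [|x rs IH]; first by rewrite big_nil poly_act1.
by rewrite big_cons poly_actM // poly_actXsubC // => /inj.
Qed.

Section Equivariance.
Variables (F : fieldType) (g : lieAlgType F).

Definition equivariant (M Z : lieMod g) (phi : M -> Z) : Prop :=
  linear phi /\ forall x v, phi (lm_act x v) = lm_act x (phi v).

Lemma submodule_subspace (M : lieMod g) (W : set M) : submodule W -> subspace W.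
Proof. by case. Qed.

Lemma env_act_submodule (M : lieMod g) (W : set M) a v :
  submodule W -> W v -> W (env_act a v).
Proof.
move=> [W0 Wl Wx] Wv; have sW : subspace W by split.
case: (qmodP a) => p; rewrite env_actE; have Al := free_act_linear_l v.
elim/fsupp_ind: p => [|p q IHp IHq|w c]; first by rewrite (linear_fun0 Al).
  by rewrite (linear_funD Al); exact: subspaceD.
rewrite -/(fword w c) free_actE; apply: subspaceZ => //.
by elim: w => //= x w; exact: Wx.
Qed.

Lemma equivariant_env (M Z : lieMod g) (phi : M -> Z) a v :
  equivariant phi -> phi (env_act a v) = env_act a (phi v).
Proof.
move=> [phil phix]; case: (qmodP a) => p; rewrite !env_actE.
have Al := free_act_linear_l v; have Al' := free_act_linear_l (phi v).
elim/fsupp_ind: p => [|p q IHp IHq|w c].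
- by rewrite (linear_fun0 Al) (linear_fun0 Al') (linear_fun0 phil).
- by rewrite (linear_funD Al) (linear_funD Al') (linear_funD phil) IHp IHq.
rewrite -/(fword w c) !free_actE (linear_funZ phil); congr (_ *: _).
by elim: w => //= x w <-; exact: phix.
Qed.

Definition schur (M : lieMod g) : Prop := forall phi : M -> M,
  equivariant phi -> exists c, forall v, phi v = c *: v.

Section Density.
Variable V : lieMod g.
Hypotheses (irrV : irreducible V) (schurV : schur V).

Fixpoint in_span (xs : seq V) (x : V) : Prop :=
  if xs is y :: ys then exists c, in_span ys (x - c *: y) else x = 0.

Definition annihilates (xs : seq V) (a : env g) : Prop :=
  forall x : V, x \in xs -> env_act a x = 0.

Lemma annihilates_subspace xs : subspace (annihilates xs).
Proof.
split=> [x _|c a b axs bxs x xxs]; first exact: linear_fun0 (env_act_linear_l x).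
by rewrite env_act_linear_l axs // bxs // scaler0 addr0.
Qed.

(** The annihilator of [xs] is a left ideal, so its orbit of v is a submodule, here nonzero. *)
Lemma annihilator_orbit xs a (v : V) :
  annihilates xs a -> env_act a v <> 0 ->
  forall u, exists2 b, annihilates xs b & env_act b v = u.
Proof.
move=> axs av.
have [|zero|//] := irrV.2 [set u | exists2 b, annihilates xs b & env_act b v = u]%classic.
  have [s0 sl] := annihilates_subspace xs; split.
  - by exists 0 => //; exact: linear_fun0 (env_act_linear_l v).
  - move=> c _ _ [b bxs <-] [b' bxs' <-]; exists (c *: b + b'); first exact: sl.
    exact: env_act_linear_l.
  - move=> x _ [b bxs <-]; exists (env_inj x * b); last by rewrite env_actM env_act_inj.
    by move=> y yxs; rewrite env_actM bxs // (linear_fun0 (env_act_linear_r _)).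
by case: av; apply: zero; exists a.
Qed.

(** Jacobson density, by induction on [xs]. Let J annihilate [ys]. If J kills y, drop y. Otherwise J
    y is all of V, and b y |-> b x, for b in J, is a well-defined endomorphism, hence a scalar c;
    then J kills x - c y. *)
Lemma density xs x :
  (forall a, annihilates xs a -> env_act a x = 0) -> in_span xs x.
Proof.
elim: xs x => [|y ys IH] x ann /=.
  by rewrite -(env_act1 x); apply: ann => z; rewrite in_nil.
have [ysy|] := pselect (forall a, annihilates ys a -> env_act a y = 0).
  exists 0; rewrite scale0r subr0; apply: IH => a ays; apply: ann => z.
  by rewrite inE => /predU1P[->|]; [exact: ysy|exact: ays].
move=> /existsNP[a /not_implyP[ays ay]].
have ann_eq b b' : annihilates ys b -> annihilates ys b' ->
    env_act b y = env_act b' y -> env_act b x = env_act b' x.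
  move=> bys bys' bb'; apply/eqP; rewrite -subr_eq0.
  rewrite -(linear_funB (env_act_linear_l x)); apply/eqP; apply: ann => z.
  rewrite inE (linear_funB (env_act_linear_l z)) => /predU1P[->|zys].
    by rewrite bb' subrr.
  by rewrite bys // bys' // subrr.
have /choice[s sP] u : exists b, annihilates ys b /\ env_act b y = u.
  by have [b] := annihilator_orbit ays ay u; exists b.
have [|c cP] := schurV (phi := fun u => env_act (s u) x).
  split=> [c u v|z u].
    rewrite -env_act_linear_l; apply: ann_eq; first exact: (sP _).1.
      by apply: (annihilates_subspace ys).2; exact: (sP _).1.
    by rewrite env_act_linear_l !(sP _).2.
  rewrite -[RHS]env_act_inj -env_actM; apply: ann_eq; first exact: (sP _).1.
    move=> w wys; rewrite env_actM (sP u).1 //.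
    exact: linear_fun0 (env_act_linear_r _).
  by rewrite env_actM env_act_inj !(sP _).2.
exists c; apply: IH => b bys; rewrite (linear_funB (env_act_linear_r b)).
rewrite (linear_funZ (env_act_linear_r b)) -cP.
rewrite (ann_eq b (s (env_act b y))) ?subrr //; first exact: (sP _).1.
by rewrite (sP _).2.
Qed.

Variables (Z : lieMod g) (H : set (V -> Z)).
Hypothesis H_equi : forall beta, H beta -> equivariant beta.
Hypothesis H_combo : forall c beta gamma, H beta -> H gamma ->
  H (fun x => c *: beta x + gamma x).

(** If x is a combination of the y_k with coefficients c_k, then beta x is absorbed by replacing
    each gamma_k with c_k beta + gamma_k, and the number of terms does not grow. *)
Lemma in_span_absorb ps beta x :
  List.Forall (fun p => H p.1) ps -> H beta -> in_span (map snd ps) x ->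
  exists qs, [/\ List.Forall (fun p => H p.1) qs, size qs = size ps
    & \sum_(p <- qs) p.1 p.2 = beta x + \sum_(p <- ps) p.1 p.2].
Proof.
move=> Hps Hb; elim: Hps x => [|[gamma y] ps' Hg _ IH] x /=.
  move=> ->; exists [::]; split=> //.
  by rewrite big_nil (linear_fun0 (H_equi Hb).1) addr0.
move=> [c /IH[qs [Hqs sqs qsE]]].
exists ((fun z => c *: beta z + gamma z, y) :: qs); split.
- by apply: List.Forall_cons => //; exact: H_combo.
- by rewrite /= sqs.
rewrite !big_cons qsE /= (linear_funB (H_equi Hb).1) (linear_funZ (H_equi Hb).1).
by rewrite !addrA [LHS](ACl (3*2*5*(1*4))) /= subrr addr0.
Qed.

(** Induction on the number of terms. If x depends linearly on the other vectors, absorb its term.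
    Otherwise some a in U(g) kills the others but not x, so a maps the sum to beta (a x), which lies
    in N. If that is 0, then beta x = 0, since a x generates V, and the term drops out. *)
Lemma nonzero_value (N : set Z) ps : submodule N ->
  List.Forall (fun p => H p.1) ps ->
  N (\sum_(p <- ps) p.1 p.2) -> \sum_(p <- ps) p.1 p.2 <> 0 ->
  exists beta x, [/\ H beta, N (beta x) & beta x <> 0].
Proof.
move=> subN; have [n] := ubnP (size ps); elim: n ps => // n IH ps.
case: ps => [|[beta x] ps] /=; first by rewrite big_nil.
rewrite ltnS => sps Hps; rewrite big_cons /= => Nt t0.
move: (Hps) => /List.Forall_cons_iff[/= Hb Hps'].
have [ann|] := pselect (forall a, annihilates (map snd ps) a -> env_act a x = 0).
  have [qs [Hqs sqs qsE]] := in_span_absorb Hps' Hb (density ann).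
  by apply: (IH qs); rewrite ?sqs ?qsE.
move=> /existsNP[a /not_implyP[aps ax]].
have aE : env_act a (beta x + \sum_(p <- ps) p.1 p.2) = beta (env_act a x).
  rewrite (linear_funD (env_act_linear_r a)) (equivariant_env _ _ (H_equi Hb)).
  rewrite (linear_fun_sum _ _ _ (env_act_linear_r a)).
  rewrite (_ : \sum_(p <- ps) _ = 0) ?addr0 //.
  elim: Hps' aps {Hps Nt t0 sps} => [|[gamma y] ps' /= Hg _ IHps] aps; first by rewrite big_nil.
  rewrite big_cons IHps => [|z zps]; last by apply: aps; rewrite inE zps orbT.
  rewrite /= -(equivariant_env _ _ (H_equi Hg)) aps ?inE ?eqxx //.
  by rewrite (linear_fun0 (H_equi Hg).1) addr0.
have [bax|] := pselect (beta (env_act a x) = 0); last first.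
  by exists beta, (env_act a x); split=> //; rewrite -aE; exact: env_act_submodule.
have bx : beta x = 0.
  have ann1 : annihilates [::] 1 by move=> y; rewrite in_nil.
  have [|b _ <-] := @annihilator_orbit [::] 1 (env_act a x) ann1 _ x.
    by rewrite env_act1.
  by rewrite (equivariant_env _ _ (H_equi Hb)) bax (linear_fun0 (env_act_linear_r b)).
by move: Nt t0; rewrite bx add0r; exact: IH.
Qed.

End Density.
End Equivariance.

Section Schur.
Variables (F : closedFieldType) (g : finLieAlgType F) (V : lieMod g).

Lemma lspan_range_sum (e : nat -> V) y : lspan (range e) y ->
  exists n (c : 'I_n -> F), y = \sum_(l < n) c l *: e l.
Proof.
pose E l (c : F^o) := (c : F) *: e l.
have El l : linear (E l) by move=> c d d'; rewrite /E scalerDl scalerA.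
have [G0 Gl] := graded_sums_subspace El.
suff ex : lspan (range e) y -> exists n s, y = graded_sum E n s.
  by move=> /ex[n [s ->]]; exists n, (fun l => s l).
elim=> [//|c x z [k _ <-] _]; apply: Gl.
by rewrite -[e k]scale1r; exact: (graded_sum_single El k 1).
Qed.

(** Dixmier's form of Schur's lemma: words in a finite basis of g applied to one vector span V, so
    its dimension is countable; kernel and image of phi - c are submodules, so phi - c is zero or
    bijective. *)
Lemma irreducible_schur : ~ countable [set: F] -> irreducible V -> schur V.
Proof.
move=> Fbig irrV phi [phil phix].
have [[v v0] irr] := irrV.
pose b := vbasis {:g}.
pose word (w : seq 'I_(\dim {:g})) := foldr (fun (i : 'I_(\dim {:g})) u => lm_act b`_i u) v w.
pose e n := if unpickle n is Some w then word w else 0.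
have eE w : e (pickle w) = word w by rewrite /e pickleK.
have subS : submodule (fun y => lspan (range e) y).
  split=> [|c u w su sw|x y]; first exact: lspan0.
    by apply: lspanD => //; exact: lspanZ.
  have stable w : lspan (range e) (lm_act x (word w)).
    rewrite (coord_vbasis (memvf x)) (linear_fun_sum _ _ _ (lm_act_linear_l (word w))).
    apply: (big_ind (lspan (range e))) => [|y1 y2|i _]; [exact: lspan0|exact: lspanD|].
    rewrite (linear_funZ (lm_act_linear_l _)); apply: lspanZ; apply: lspan_in.
    by exists (pickle (i :: w)) => //; rewrite eE.
  elim=> [|c _ z [k _ <-] _ IH]; first by rewrite (linear_fun0 (lm_act_linear_r x)); exact: lspan0.
  rewrite lm_act_linear_r; apply: lspanD => //; apply: lspanZ.
  rewrite /e; case: unpickle => // ; rewrite (linear_fun0 (lm_act_linear_r x)); exact: lspan0.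
have full y : lspan (range e) y.
  have [zero|//] := irr _ subS; case: v0; apply: zero.
  by apply: lspan_in; exists (pickle ([::] : seq 'I_(\dim {:g}))) => //; rewrite eE.
apply: (countable_scalar Fbig phil v0 (e := e)) => [y|c]; first exact: lspan_range_sum.
have [|inj|all] := irr [set y | phi y = c *: y]%classic; last by left.
  split=> [|d x y /= xE yE|x y /= yE]; first by rewrite /= (linear_fun0 phil) scaler0.
    by rewrite phil xE yE scalerDr !scalerA mulrC.
  by rewrite phix yE (linear_funZ (lm_act_linear_r x)).
have [|im0|surj] := irr [set y | exists u, phi u - c *: u = y]%classic.
- split=> [|d _ _ [x <-] [y <-]|x _ [y <-]].
  + by exists 0; rewrite (linear_fun0 phil) scaler0 subrr.
  + exists (d *: x + y); rewrite phil scalerDr opprD addrACA scalerBr.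
    by rewrite !scalerA mulrC.
  + exists (lm_act x y); rewrite phix (linear_funB (lm_act_linear_r x)).
    by rewrite (linear_funZ (lm_act_linear_r x)).
- by left=> y; apply/eqP; rewrite -subr_eq0; apply/eqP; apply: im0; exists y.
- by right.
Qed.

End Schur.

(** * The outer tensor product *)

Section TrivialModule.
Variables (F : fieldType) (g : lieAlgType F) (M : lmodType F).

Lemma zero_linear (U : lmodType F) : linear (fun _ : U => 0 : M).
Proof. by move=> c u v; rewrite scaler0 addr0. Qed.

Lemma zero_bracket (x y : g) (v : M) : 0 = 0 - 0 :> M.
Proof. by rewrite subrr. Qed.

(** With one trivial factor, [tensor_act] is the action on the other factor alone. *)
Definition trivial_mod : lieMod g :=
  @LieMod F g M (fun _ _ => 0) (fun=> @zero_linear g) (fun=> @zero_linear M) zero_bracket.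

End TrivialModule.

Section SiteModules.
Variables (F : fieldType) (g : finLieAlgType F) (I : finType).
Variables (V : I -> lieMod g) (L : lieMod (affine_hat g)).

Local Notation Vl := (fun i => V i : lmodType F).
Local Notation fam := (vfam Vl).
Local Notation E := (mtensor Vl).

Definition site_mod (i : I) : lieMod g :=
  @LieMod F g E (fun x => site_act x i) (fun t c x y => site_act_linear_l i t c x y)
    (fun x => site_act_linear_r x i) (fun x y t => site_act_bracket x y i t).

Definition outer_tensor : lmodType F := tensor E L.
Local Notation T := outer_tensor.

(* [g] acts on the [i]-th factor only: [L] is made a trivial module. *)
Definition site_tensor i : lieMod g := @LieMod F g T
  (@tensor_act F g (site_mod i) (trivial_mod g L))
  (@tensor_act_linear_l F g (site_mod i) (trivial_mod g L))
  (@tensor_act_linear_r F g (site_mod i) (trivial_mod g L))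
  (@tensor_act_bracket F g (site_mod i) (trivial_mod g L)).

Definition right_tensor : lieMod (affine_hat g) := @LieMod F (affine_hat g) T
  (@tensor_act F _ (trivial_mod (affine_hat g) E) L)
  (@tensor_act_linear_l F _ (trivial_mod (affine_hat g) E) L)
  (@tensor_act_linear_r F _ (trivial_mod (affine_hat g) E) L)
  (@tensor_act_bracket F _ (trivial_mod (affine_hat g) E) L).

Definition pure (v : fam) (l : L) : T := tpure (mpure v) l.

Lemma pure_linear_l v i l : linear (fun x : V i => pure (@vset _ _ Vl v i x) l).
Proof. by move=> c x y; rewrite /pure (@mpure_linear F I Vl v i) tpure_linear_l. Qed.

Lemma pure_linear_r v : linear (pure v).
Proof. exact: tpure_linear_r. Qed.

Lemma site_tensorE i x v l :
  @lm_act _ _ (site_tensor i) x (pure v l) = pure (@vset _ _ Vl v i (lm_act x (v i))) l.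
Proof.
rewrite /= /pure tensor_actE /= (linear_fun0 (@tpure_linear_r _ _ _ _)) addr0.
by rewrite /site_act (@mactE F I Vl i) //; exact: lm_act_linear_r.
Qed.

Lemma right_tensorE u v l : @lm_act _ _ right_tensor u (pure v l) = pure v (lm_act u l).
Proof.
by rewrite /= /pure tensor_actE /= (linear_fun0 (@tpure_linear_l _ _ _ _)) add0r.
Qed.

Lemma pure_ext (W : lmodType F) (p q : T -> W) : linear p -> linear q ->
  (forall v l, p (pure v l) = q (pure v l)) -> p =1 q.
Proof.
move=> pl ql pq; apply: tensor_ext => // e l; move: e.
apply: (mtensor_ext (p := fun e => p (tpure e l)) (q := fun e => q (tpure e l))).
- by move=> c u v; rewrite tpure_linear_l pl.
- by move=> c u v; rewrite tpure_linear_l ql.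
- by move=> v; exact: pq.
Qed.

Lemma pure_spanned (N : set T) :
  subspace N -> (forall v l, N (pure v l)) -> forall t, N t.
Proof.
move=> sN Np; apply: (@spanned_of_ext F T (fam * L) (fun p => pure p.1 p.2)) => // p q pl ql pq.
by apply: pure_ext => // v l; exact: (pq (v, l)).
Qed.

Lemma vset_same (v : fam) i : @vset _ _ Vl v i (v i) = v.
Proof.
apply/functional_extensionality_dep => j; have [<-|ij] := eqVneq i j.
  by rewrite vset_in.
by rewrite vset_out.
Qed.

(** Functionals equal to 1 on each v_i and on l multiply to a linear form on the tensor product with
    value 1 on [pure v l]. *)
Lemma pure_neq0 v l : (forall i, v i <> 0) -> l <> 0 -> pure v l <> 0.
Proof.
move=> v0 l0.
have /choice[f fP] i : exists f : fam -> F,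
    [/\ forall w j x, j != i -> f (@vset _ _ Vl w j x) = f w,
        forall w, linear (fun x => f (@vset _ _ Vl w i x) : F^o) & f v = 1].
  have [f fl fv] := linear_functional (v0 i); exists (fun w => f (w i)); split=> // w.
    by move=> j x ji; rewrite vset_out.
  by move=> c x y; rewrite !vset_in fl.
have [h hl hl1] := linear_functional l0.
pose B w := \prod_i f i w.
have Bl w i : linear (fun x => B (@vset _ _ Vl w i x) : F^o).
  have BE z : B (@vset _ _ Vl w i z) = f i (@vset _ _ Vl w i z) * \prod_(j | j != i) f j w.
    rewrite /B (bigD1 i) //; congr (_ * _); apply: eq_bigr => j ji.
    by have [fj _ _] := fP j; rewrite fj // eq_sym.
  move=> c x y; have [_ fl _] := fP i; rewrite !BE.
  by have -> := fl w c x y; rewrite mulrDl -mulrA.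
have ml := mlift_linear Bl.
pose C (e : E) (l : L) : F^o := (mlift (B : fam -> F^o) e : F) * h l.
have Cl m : linear (C ^~ m).
  by move=> c x y; rewrite /C ml mulrDl -mulrA.
have Cr e : linear (C e).
  by move=> c x y; rewrite /C hl mulrDr mulrCA.
move=> vl0; have : C (mpure v) l = 0.
  rewrite -(tliftE Cl Cr) -/(pure v l) vl0.
  exact: linear_fun0 (tlift_linear Cl Cr).
rewrite /C hl1 mulr1 mliftE // /B big1 => [/eqP|i _]; last by have [_ _] := fP i.
by rewrite oner_eq0.
Qed.

Definition pure_sum (r : seq (fam * L)) : T := \sum_(p <- r) pure p.1 p.2.

Lemma pure_sum_combo c r s :
  c *: pure_sum r + pure_sum s = pure_sum ([seq (p.1, c *: p.2) | p <- r] ++ s).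
Proof.
rewrite /pure_sum big_cat big_map scaler_sumr; congr (_ + _); apply: eq_bigr => p _.
by rewrite (linear_funZ (pure_linear_r _)).
Qed.

Lemma pure_sumP (t : T) : exists r, t = pure_sum r.
Proof.
move: t; apply: pure_spanned => [|v l]; last by exists [:: (v, l)]; rewrite /pure_sum big_seq1.
split=> [|c _ _ [r ->] [s ->]]; first by exists [::]; rewrite /pure_sum big_nil.
by eexists; exact: pure_sum_combo.
Qed.

Hypotheses (irrV : forall i, irreducible (V i)) (schurV : forall i, schur (V i)).
Hypothesis irrL : irreducible L.

Section Invariant.
Variable N : set T.
Hypothesis siteN : forall i, submodule (M := site_tensor i) N.
Hypothesis rightN : submodule (M := right_tensor) N.

Let subN : subspace N. Proof. exact: submodule_subspace rightN. Qed.

(* By density, the vectors at site [i] can be made equal without killing the *)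
(* tensor, one site after the other.                                         *)
Lemma align_sites (s : seq I) (t : T) : N t -> t <> 0 ->
  exists (b : fam) (r : seq (fam * L)), [/\ forall p i, p \in r -> i \in s -> p.1 i = b i,
    N (pure_sum r) & pure_sum r <> 0].
Proof.
move=> Nt t0; elim: s => [|i s [b [r [rb Nr r0]]]].
  have [r rE] := pure_sumP t; exists (fun i => 0 : V i), r.
  by rewrite -rE; split.
(* Maps inserting x at site i of a fixed sum of pure tensors aligned on [s]; site i itself is exempt
   because it is overwritten. *)
pose H (beta : V i -> site_tensor i) := exists q : seq (fam * L),
  (forall p j, p \in q -> j \in s -> j != i -> p.1 j = b j) /\
  forall x, beta x = \sum_(p <- q) pure (@vset _ _ Vl p.1 i x) p.2.
have Hequi beta : H beta -> equivariant beta.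
  move=> [q [_ qE]]; split=> [c x y|x u]; rewrite !qE.
    rewrite scaler_sumr -big_split; apply: eq_bigr => p _; exact: pure_linear_l.
  rewrite (linear_fun_sum _ _ _ (@lm_act_linear_r _ _ (site_tensor i) x)).
  by apply: eq_bigr => p _; rewrite site_tensorE vset_in vset_vset.
have Hcombo c beta gamma : H beta -> H gamma -> H (fun x => c *: beta x + gamma x).
  move=> [q [qb qE]] [q' [qb' qE']]; exists ([seq (p.1, c *: p.2) | p <- q] ++ q'); split.
    move=> p j; rewrite mem_cat => /orP[/mapP[p' p'q ->]|]; [exact: (qb p')|exact: (qb' p)].
  move=> x; rewrite qE qE' big_cat big_map scaler_sumr; congr (_ + _).
  by apply: eq_bigr => p _; rewrite (linear_funZ (pure_linear_r _)).
pose ps := [seq ((fun x => pure (@vset _ _ Vl p.1 i x) p.2) : V i -> site_tensor i, p.1 i)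
  | p <- r].
have psE : \sum_(p <- ps) p.1 p.2 = pure_sum r :> site_tensor i.
  by rewrite big_map; apply: eq_bigr => p _ /=; rewrite vset_same.
have Hps : List.Forall (fun p => H p.1) ps.
  have : forall p j, p \in r -> j \in s -> p.1 j = b j by [].
  rewrite /ps; elim: r {rb Nr r0 ps psE} => [|p r IH] rb /=; first exact: List.Forall_nil.
  apply: List.Forall_cons; last by apply: IH => q j qr; apply: rb; rewrite inE qr orbT.
  exists [:: p]; split=> [q j|x]; last by rewrite big_seq1.
  by rewrite inE => /eqP -> js _; apply: rb => //; rewrite inE eqxx.
have [||beta [x [[q [qb qE]] Nx x0]]] :=
  nonzero_value (irrV i) (@schurV i) Hequi Hcombo (siteN i) Hps.
- by rewrite psE.
- by rewrite psE.
have sE : beta x = pure_sum [seq (@vset _ _ Vl p.1 i x, p.2) | p <- q].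
  by rewrite qE /pure_sum big_map.
exists (@vset _ _ Vl b i x), [seq (@vset _ _ Vl p.1 i x, p.2) | p <- q].
split; [|by rewrite -sE|by rewrite -sE].
move=> _ j /mapP[p pq ->] /=; rewrite inE; have [->|ji] := eqVneq j i; first by rewrite !vset_in.
by move=> js; rewrite !vset_out 1?eq_sym //; exact: qb.
Qed.

(** One site at a time: the admissible entries at site i form a submodule of V_i containing the
    nonzero [b i]. *)
Lemma spread_sites (b : fam) l (s : seq I) (v : fam) : (forall i, b i <> 0) ->
  N (pure b l) -> (forall i, i \notin s -> v i = b i) -> N (pure v l).
Proof.
move=> b0 Nb; elim: s v => [|i s IH] v vb.
  by rewrite (_ : v = b) //; apply/functional_extensionality_dep => j; exact: vb.
have [|zero|full] := (irrV i).2 [set x | N (pure (@vset _ _ Vl v i x) l)]%classic.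
- split=> [|c x y /= Nx Ny|x y /= Ny].
  + by rewrite /= (linear_fun0 (@pure_linear_l v i l)); exact: subN.1.
  + by rewrite pure_linear_l; exact: subN.2.
  + have [_ _ /(_ x _ Ny)] := siteN i.
    by rewrite site_tensorE vset_in vset_vset.
- case: (b0 i); apply: zero; apply: IH => j js.
  have [->|ji] := eqVneq j i; first by rewrite vset_in.
  by rewrite vset_out 1?eq_sym // vb // inE negb_or ji.
by have := full (v i); rewrite /= vset_same.
Qed.

(** Once aligned at all sites, a sum of pure tensors is a single pure tensor; it is then spread over
    every V_i and over L. *)
Lemma outer_tensor_irreducible : (forall t, N t -> t = 0) \/ forall t, N t.
Proof.
have [zero|] := pselect (forall t, N t -> t = 0); first by left.
move=> /existsNP[t /not_implyP[Nt t0]]; right.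
have [b [r [rb Nr r0]]] := align_sites (enum I) Nt t0.
pose l := \sum_(p <- r) p.2.
have rE : pure_sum r = pure b l.
  rewrite /l (linear_fun_sum _ _ _ (pure_linear_r b)); apply: eq_big_seq => p pr.
  rewrite (_ : p.1 = b) //; apply/functional_extensionality_dep => i.
  by apply: rb => //; exact: mem_enum.
rewrite rE in Nr r0.
have b0 i : b i <> 0.
  move=> bi; apply: r0; rewrite -(vset_same b i) bi.
  exact: (linear_fun0 (@pure_linear_l b i l)).
have l0 : l <> 0 by move=> l0; apply: r0; rewrite l0 (linear_fun0 (pure_linear_r b)).
apply: pure_spanned => // v.
have Nv : N (pure v l).
  by apply: (spread_sites (s := enum I) b0 Nr) => i; rewrite mem_enum.
have [|zero|//] := irrL.2 [set l' | N (pure v l')]%classic.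
  split=> [|c x y /= Nx Ny|u x /= Nx].
  - by rewrite /= (linear_fun0 (pure_linear_r v)); exact: subN.1.
  - by rewrite pure_linear_r; exact: subN.2.
  - by have [_ _ /(_ u _ Nx)] := rightN; rewrite right_tensorE.
by case: l0; apply: zero.
Qed.

End Invariant.

Lemma site_right_comm i x u (t : T) :
  @lm_act _ _ (site_tensor i) x (@lm_act _ _ right_tensor u t) =
    @lm_act _ _ right_tensor u (@lm_act _ _ (site_tensor i) x t).
Proof.
have sl := @lm_act_linear_r _ _ (site_tensor i) x.
have rl := @lm_act_linear_r _ _ right_tensor u.
move: t; apply: pure_ext => [c t s|c t s|v l]; last first.
- by rewrite right_tensorE !site_tensorE right_tensorE.
- by rewrite sl rl.
- by rewrite rl sl.
Qed.

Lemma tensor_nonzero : exists (v : fam) (l : L), (forall i, v i <> 0) /\ l <> 0.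
Proof.
have [[l l0] _] := irrL.
have v0 i : exists x : V i, x <> 0 by have [] := irrV i.
exists (fun i => projT1 (cid (v0 i))), l; split=> // i.
exact: projT2 (cid (v0 i)).
Qed.

(** The joint invariants are stable under all site actions and under the action on L, so they are
    zero or everything; a pure tensor with v at site i excludes the latter. *)
Lemma site_invariants i (x : g) (v : V i) (t : T) : lm_act x v <> 0 ->
  (forall j y, @lm_act _ _ (site_tensor j) y t = 0) -> t = 0.
Proof.
move=> xv0; move: t.
pose N (t : T) := forall j y, @lm_act _ _ (site_tensor j) y t = 0.
have sl j y := @lm_act_linear_r _ _ (site_tensor j) y.
have N0 : N 0 by move=> j y; exact: linear_fun0 (sl j y).
have Nl c t s : N t -> N s -> N (c *: t + s).
  by move=> Nt Ns j y; rewrite sl Nt Ns scaler0 addr0.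
have [j||//|full] := @outer_tensor_irreducible N.
- by split=> // y t Nt; rewrite Nt.
- split=> // u t Nt j y; rewrite site_right_comm Nt.
  exact: linear_fun0 (@lm_act_linear_r _ _ right_tensor u).
have [w [l [w0 l0]]] := tensor_nonzero.
have := full (pure (@vset _ _ Vl w i v) l) i x.
rewrite site_tensorE vset_in vset_vset => z; exfalso; move: z.
apply: pure_neq0 => // j; have [<-|ij] := eqVneq i j; first by rewrite vset_in.
by rewrite vset_out //; exact: w0.
Qed.

End SiteModules.

(** * Induction to the affine algebra *)

Section FrobeniusReciprocity.
Variables (F : fieldType) (g g' : lieAlgType F) (phi : g -> g').
Variables (M : lieMod g) (X : lieMod g') (j : M -> X).
Hypotheses (phi_linear : linear phi)
  (phi_bracket : forall x y, phi (bracket x y) = bracket (phi x) (phi y)).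
Hypotheses (jl : linear j) (jE : forall x m, j (lm_act x m) = lm_act (phi x) (j m)).

Lemma env_act_restrict a m : env_act (env_map phi a) (j m) = j (env_act a m).
Proof.
case: (qmodP a) => p; rewrite env_mapE // !env_actE.
have Al := free_act_linear_l m; have Al' := free_act_linear_l (j m).
have fl := free_map_linear phi.
elim/fsupp_ind: p => [|p q IHp IHq|w c].
- by rewrite (linear_fun0 fl) (linear_fun0 Al) (linear_fun0 Al') (linear_fun0 jl).
- by rewrite (linear_funD fl) (linear_funD Al) (linear_funD Al') (linear_funD jl) IHp IHq.
rewrite -/(fword w c) free_mapE !free_actE (linear_funZ jl); congr (_ *: _).
by elim: w => //= x w ->; rewrite jE.
Qed.

(** Frobenius reciprocity: u (x) m |-> u (j m) is well defined on the induced module and extends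
    j. *)
Lemma ind_pure1_eq0 m : ind_pure phi (1 : env g') m = 0 -> j m = 0.
Proof.
pose B (u : env g') (m : M) := env_act u (j m).
have Bl n : linear (B ^~ n) by move=> c u v; exact: env_act_linear_l.
have Br u : linear (B u) by move=> c n n'; rewrite /B jl env_act_linear_r.
have Tl := tlift_linear Bl Br.
have Trel r : balanced_rel (fun (u : env g') (a : env g) => u * env_map phi a)
    (@env_act F g M) r -> tlift B r = 0.
  case=> u [a [n ->]]; rewrite (linear_funB Tl) !(tliftE Bl Br) /B.
  by rewrite env_actM env_act_restrict subrr.
move=> m0; rewrite -[LHS]env_act1 -[LHS](tliftE Bl Br) -(qliftE _ Tl Trel).
rewrite -/(ind_pure phi (1 : env g') m) m0.
exact: linear_fun0 (qlift_linear Tl Trel).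
Qed.

End FrobeniusReciprocity.

Lemma commutator_cancel (V : zmodType) (p q z e e' x1 x2 x3 x4 x5 x6 x7 x8 : V) :
  p - q - z + e - e' + z =
    p + x1 + x2 + (x3 + x4 + x5) + (x6 + e + x7 + x8)
    - (q + x3 + x6 + (x1 + x4 + x7) + (x2 + e' + x5 + x8)).
Proof.
rewrite !addrA [X in _ = X - _](ACl ((1*8)*(2*3*4*5*6*7*9*10))).
rewrite [X in _ = _ - X](ACl ((1*8)*(4*7*2*5*9*3*6*10))) /=.
have cancel (y y' s : V) : (y + s) - (y' + s) = y - y' by rewrite opprD addrACA subrr addr0.
rewrite cancel opprD addrA.
by rewrite [LHS](ACl (1*4*2*5*(3*6))) /= addNr addr0.
Qed.

(** * A module of functions containing a copy of M *)

Section LoopModule.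
Variables (F : fieldType) (g : finLieAlgType F) (M : lieMod (affine_hat g)).

Local Notation X := (int -> M).
Local Notation hat f c := ((f, c) : affine_hat g).

Lemma hat_act_split (f : loop g) (c : F) (v : M) :
  lm_act (hat f c) v = lm_act (hat f 0) v + c *: lm_act (hat 0 1) v.
Proof.
rewrite addrC -(linear_funZ (lm_act_linear_l v)) -(linear_funD (lm_act_linear_l v)).
congr lm_act; congr pair; rewrite /=; first by rewrite scaler0 add0r.
by rewrite addr0 regular_scale mulr1.
Qed.

Lemma hat_central (f : loop g) (v : M) :
  lm_act (hat 0 1) (lm_act (hat f 0) v) = lm_act (hat f 0) (lm_act (hat 0 1) v).
Proof.
apply/eqP; rewrite -subr_eq0 -lm_act_bracket; apply/eqP.
rewrite (_ : bracket _ _ = 0) ?(linear_fun0 (lm_act_linear_l v)) //.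
congr pair; [exact: linear_fun0 (loop_bracket_linear_l f)|].
exact: linear_fun0 (loop_cocycle_linear_l f).
Qed.

(* On functions [int -> M] the element [x (x) t^k] acts as a weighted shift and *)
(* [d] as multiplication by the coordinate; [M] embeds as the constants.        *)
Definition shift_act (f : loop g) (h : X) : X :=
  fun n => fext (fun k x => lm_act (hat (xt k x) 0) (h (n - k))) f.

Definition central_act (h : X) : X := fun n => lm_act (hat 0 1) (h n).

Definition degree_act (h : X) : X := fun n => n%:~R *: h n.

Lemma hat_xt_linear k (v : M) : linear (fun x : g => lm_act (hat (xt k x) 0) v).
Proof.
move=> c x y; rewrite xt_linear -lm_act_linear_l; congr lm_act; congr pair.
by rewrite /= scaler0 addr0.
Qed.

Lemma shift_act_linear_l h : linear (shift_act ^~ h).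
Proof.
move=> c f f'; apply/funext => n; rewrite /shift_act fext_linear // => k.
exact: hat_xt_linear.
Qed.

Lemma shift_act_linear_r f : linear (shift_act f).
Proof.
move=> c h h'; apply/funext => n; rewrite /shift_act.
apply: fext_combo => [k|k|k x]; try exact: hat_xt_linear.
exact: lm_act_linear_r.
Qed.

Lemma shift_actE k x h n : shift_act (xt k x) h n = lm_act (hat (xt k x) 0) (h (n - k)).
Proof. by rewrite /shift_act fext_linE // => l; exact: hat_xt_linear. Qed.

Lemma central_act_linear : linear central_act.
Proof. by move=> c h h'; apply/funext => n; exact: lm_act_linear_r. Qed.

Lemma degree_act_linear : linear degree_act.
Proof.
move=> c h h'; apply/funext => n.
rewrite -[LHS]/(n%:~R *: (c *: h n + h' n)) scalerDr scalerA mulrC -scalerA.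
by [].
Qed.

Lemma shift_central f h : central_act (shift_act f h) = shift_act f (central_act h).
Proof.
have sl := shift_act_linear_l h; have sl' := shift_act_linear_l (central_act h).
elim/loop_ind: f => [|f f' IH IH'|k x].
- by rewrite (linear_fun0 sl) (linear_fun0 sl') (linear_fun0 central_act_linear).
- by rewrite (linear_funD sl) (linear_funD sl') (linear_funD central_act_linear) IH IH'.
by apply/funext => n; rewrite /central_act !shift_actE hat_central.
Qed.

Lemma degree_central h : degree_act (central_act h) = central_act (degree_act h).
Proof.
apply/funext => n; rewrite /degree_act /central_act.
by rewrite (linear_funZ (lm_act_linear_r _)).
Qed.

Lemma shift_degree f h :
  degree_act (shift_act f h) = shift_act f (degree_act h) + shift_act (loop_deriv f) h.
Proof.
have sl := shift_act_linear_l h; have sl' := shift_act_linear_l (degree_act h).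
have dl := loop_deriv_linear (g := g).
elim/loop_ind: f => [|f f' IH IH'|k x].
- rewrite (linear_fun0 dl) (linear_fun0 sl) (linear_fun0 sl') (linear_fun0 degree_act_linear).
  by rewrite addr0.
- rewrite (linear_funD dl) !(linear_funD sl) (linear_funD sl') (linear_funD degree_act_linear).
  by rewrite IH IH' addrACA.
rewrite loop_derivE; apply/funext => n.
rewrite -[RHS]/(shift_act (xt k x) (degree_act h) n + shift_act (xt k (k%:~R *: x)) h n).
rewrite /degree_act !shift_actE (linear_funZ (lm_act_linear_r _)).
by rewrite (linear_funZ (hat_xt_linear k _)) -scalerDl -intrD subrK.
Qed.

Lemma shift_bracket f f' h :
  shift_act f (shift_act f' h) - shift_act f' (shift_act f h) =
    shift_act (loop_bracket f f') h + (loop_cocycle f f' : F) *: central_act h.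
Proof.
have sl := shift_act_linear_l; have sr := shift_act_linear_r.
have bl := loop_bracket_linear_l (g := g); have br := loop_bracket_linear_r (g := g).
have cl := loop_cocycle_linear_l (g := g); have cr := loop_cocycle_linear_r (g := g).
elim/loop_ind: f => [|f1 f2 IH1 IH2|k x].
- rewrite (linear_fun0 (bl _)) (linear_fun0 (cl _)) !(linear_fun0 (sl _)).
  by rewrite (linear_fun0 (sr _)) scale0r subrr addr0.
- rewrite (linear_funD (bl _)) (linear_funD (cl _)) !(linear_funD (sl _)).
  by rewrite (linear_funD (sr _)) scalerDl opprD addrACA IH1 IH2 addrACA.
elim/loop_ind: f' => [|f1 f2 IH1 IH2|l y].
- rewrite (linear_fun0 (br _)) (linear_fun0 (cr _)) !(linear_fun0 (sl _)).
  by rewrite (linear_fun0 (sr _)) scale0r subrr addr0.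
- rewrite (linear_funD (br _)) (linear_funD (cr _)) !(linear_funD (sl _)).
  by rewrite (linear_funD (sr _)) scalerDl opprD addrACA IH1 IH2 addrACA.
rewrite loop_bracketE loop_cocycleE; apply/funext => n.
set c := _ * _ * _.
transitivity (lm_act (hat (xt (k + l) (bracket x y)) c) (h (n - (k + l)))); last first.
  rewrite hat_act_split -[RHS]/(shift_act _ _ _ + c *: _) shift_actE /central_act.
  (* The cocycle is nonzero only for k + l = 0, and there the total shift is trivial, as for the
     central action. *)
  congr (_ + _); rewrite /c; have [->|_] := eqVneq (k + l) 0; first by rewrite subr0.
  by rewrite mulr0 !scale0r.
rewrite -[LHS]/(shift_act _ (shift_act _ h) n - shift_act _ (shift_act _ h) n) !shift_actE.
rewrite -addrA -opprD [n - l - k]addrAC -addrA -opprD -lm_act_bracket.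
by congr lm_act; rewrite /c -loop_bracketE -loop_cocycleE.
Qed.

Definition model_act (u : affine g) (h : X) : X :=
  shift_act u.1.1 h + (u.1.2 : F) *: central_act h + (u.2 : F) *: degree_act h.

Lemma model_act_linear_l h : linear (model_act ^~ h).
Proof.
move=> c u v; rewrite /model_act /= shift_act_linear_l !scalerDl !scalerDr !scalerA.
by rewrite add3ACA.
Qed.

Lemma model_act_linear_r u : linear (model_act u).
Proof.
move=> c h h'; rewrite /model_act shift_act_linear_r central_act_linear degree_act_linear.
rewrite !scalerDr !scalerA add3ACA.
by rewrite [c * u.1.2]mulrC [c * u.2]mulrC.
Qed.

Lemma model_act_bracket u v h :
  model_act (bracket u v) h = model_act u (model_act v h) - model_act v (model_act u h).
Proof.
case: u => [[f c] b]; case: v => [[f' c'] b'].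
have sl := shift_act_linear_l h; have sr := shift_act_linear_r.
have kl := central_act_linear; have dl := degree_act_linear.
rewrite /model_act /= scale0r addr0.
rewrite (linear_funB sl) (linear_funD sl) !(linear_funZ sl).
rewrite !(linear_funD (sr _)) !(linear_funZ (sr _)).
rewrite !(linear_funD kl) !(linear_funZ kl) !(linear_funD dl) !(linear_funZ dl).
rewrite !shift_central !degree_central !shift_degree.
have := shift_bracket f f' h.
move: (shift_act f (shift_act f' h)) (shift_act f' (shift_act f h)) => p q.
move/eqP; rewrite -subr_eq => /eqP <-.
rewrite !scalerDr !scalerA [c' * c]mulrC [c' * b]mulrC [b' * c]mulrC [b' * b]mulrC.
exact: commutator_cancel.
Qed.

Definition model : lieMod (affine g) :=
  LieMod model_act_linear_l model_act_linear_r model_act_bracket.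

Lemma model_const_linear : linear (fun (v : M) => (fun=> v) : model).
Proof. by []. Qed.

Lemma model_constE (u : affine_hat g) (v : M) :
  (fun=> lm_act u v) = @lm_act _ _ model (hat_incl u) (fun=> v).
Proof.
case: u => f c; apply/funext => n.
rewrite -[RHS]/(shift_act f (fun=> v) n + c *: lm_act (hat 0 1) v + (0 : F) *: (n%:~R *: v)).
rewrite scale0r addr0 hat_act_split; congr (_ + _).
have sl := shift_act_linear_l (fun=> v); have al := lm_act_linear_l v.
elim/loop_ind: f => [|f f' IH IH'|k x]; last by rewrite shift_actE.
  by rewrite (linear_fun0 sl) (linear_fun0 al).
rewrite (linear_funD sl) -[RHS]/(shift_act f (fun=> v) n + shift_act f' (fun=> v) n).
by rewrite -IH -IH' -(linear_funD al); congr lm_act; congr pair; rewrite /= addr0.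
Qed.

(** The embedding of M in [model] as constant functions factors through m |-> 1 (x) m. *)
Lemma ind_d_pure1_inj (v : M) : ind_pure (@hat_incl F g) (1 : env (affine g)) v = 0 -> v = 0.
Proof.
move=> v0; have := ind_pure1_eq0 (@hat_incl_linear F g) (@hat_incl_bracket F g)
  model_const_linear model_constE v0.
by move=> /(congr1 (@^~ 0)).
Qed.

End LoopModule.

(** * Irreducibility of E (x) L *)

Section EvaluationTensor.
Variables (F : fieldType) (g : finLieAlgType F) (I : finType).
Variables (V : I -> lieMod g) (L : lieMod (affine_hat g)).
Variables (a : I -> F) (a_neq0 : forall i, a i != 0).

Local Notation Vl := (fun i => V i : lmodType F).
Local Notation T := (outer_tensor V L).
Local Notation hat f c := ((f, c) : affine_hat g).

(* [tensor_mod (eval_mod V a_neq0) L] with its carrier syntactically that of *)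
(* [site_tensor] and [right_tensor]; otherwise comparing them is very slow.  *)
Definition eval_tensor : lieMod (affine_hat g) := @LieMod F _ T
  (@tensor_act F _ (eval_mod V a_neq0) L)
  (@tensor_act_linear_l F _ (eval_mod V a_neq0) L)
  (@tensor_act_linear_r F _ (eval_mod V a_neq0) L)
  (@tensor_act_bracket F _ (eval_mod V a_neq0) L).
Local Notation M := eval_tensor.

(* Typed in [T] and not in a carrier depending on [i], for the sums over [i]. *)
Definition site i (x : g) : T -> T := @lm_act _ _ (site_tensor V L i) x.
Definition right (u : affine_hat g) : T -> T := @lm_act _ _ (right_tensor V L) u.

Lemma site_linear_l i t : linear (fun x => site i x t).
Proof. exact: (@lm_act_linear_l _ _ (site_tensor V L i)). Qed.

Lemma site_linear_r i x : linear (site i x).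
Proof. exact: (@lm_act_linear_r _ _ (site_tensor V L i)). Qed.

Lemma right_linear_r u : linear (right u).
Proof. exact: (@lm_act_linear_r _ _ (right_tensor V L)). Qed.

Definition eval_term (t : T) (k : int) (x : g) : T := \sum_i a i ^ k *: site i x t.

Definition eval_part (f : loop g) (t : T) : T := fext (eval_term t) f.

Lemma eval_term_linear t k : linear (eval_term t k).
Proof.
move=> c x y; rewrite /eval_term scaler_sumr -big_split; apply: eq_bigr => i _.
by rewrite site_linear_l scalerDr !scalerA mulrC.
Qed.

Lemma eval_part_linear_l t : linear (eval_part ^~ t).
Proof. by apply: fext_linear => k; exact: eval_term_linear. Qed.

Lemma eval_part_linear_r f : linear (eval_part f).
Proof.
move=> c t s; rewrite /eval_part.
apply: (@fext_combo _ _ _ _ (eval_term t) (eval_term s)) => [k|k|k x].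
- exact: eval_term_linear.
- exact: eval_term_linear.
rewrite /eval_term scaler_sumr -big_split; apply: eq_bigr => i _.
by rewrite site_linear_r scalerDr !scalerA mulrC.
Qed.

Lemma eval_partE k x t : eval_part (xt k x) t = \sum_i a i ^ k *: site i x t.
Proof. by rewrite /eval_part fext_linE // => l; exact: eval_term_linear. Qed.

Lemma tensor_act_split (u : affine_hat g) (t : T) :
  @lm_act _ _ M u t = eval_part u.1 t + right u t.
Proof.
have ml := @lm_act_linear_r _ _ M u; have el := eval_part_linear_r u.1.
have rl := right_linear_r u.
move: t; apply: (@pure_ext _ _ _ V L _ _ (fun t => eval_part u.1 t + right u t)) => [//|c t s|v l].
  by rewrite el rl scalerDr addrACA.
rewrite /right right_tensorE.
have -> : @lm_act _ _ M u (pure v l) = tpure (eval_act a u (mpure v)) l + pure v (lm_act u l).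
  exact: (@tensor_actE F _ (eval_mod V a_neq0) L u (mpure v) l).
congr (_ + _).
case: u {ml el rl} => f c; rewrite /eval_act /=.
have tl := @tpure_linear_l F (mtensor Vl) L l.
have xl := xt_act_linear_l a (mpure v); have pl := eval_part_linear_l (pure v l).
elim/loop_ind: f => [|f f' IH IH'|k x].
- by rewrite (linear_fun0 (fext_linear xl)) (linear_fun0 tl) (linear_fun0 pl).
- by rewrite (linear_funD (fext_linear xl)) (linear_funD tl) (linear_funD pl) IH IH'.
rewrite eval_partE fext_linE // /xt_act (linear_fun_sum _ _ _ tl).
apply: eq_bigr => i _; rewrite (linear_funZ tl) /site site_tensorE.
by rewrite /site_act (@mactE F I Vl i) //; exact: lm_act_linear_r.
Qed.

Hypothesis tailL : forall v : L, exists k0 : nat, forall k : nat, (0 < k)%N ->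
  (k0 <= k)%N -> forall f, tail_loops k f -> lm_act (hat f 0) v = 0.

Lemma right_tail (t : T) : exists k0 : nat, forall k : nat, (k0 <= k)%N ->
  forall x, right (hat (xt k x) 0) t = 0.
Proof.
have rl := right_linear_r.
move: t; apply: pure_spanned => [|v l].
  split=> [|c t s [k0 tk] [k1 sk]]; first by exists 0 => k _ x; exact: linear_fun0 (rl _).
  exists (maxn k0 k1) => k; rewrite geq_max => /andP[kk0 kk1] x.
  by rewrite rl tk // sk // scaler0 addr0.
have [k0 k0P] := tailL l; exists k0.+1 => k kk x; rewrite /right right_tensorE (k0P k).
- exact: linear_fun0 (pure_linear_r _).
- exact: leq_ltn_trans kk.
- exact: ltnW.
by move=> n nk; rewrite /= /fsingle_fun; case: eqP nk => // ->; rewrite ltxx.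
Qed.

(** For large k the action on L disappears and only exponentials a_i^k remain. The finite family
    gives one bound for all coefficients of a vector of M[d]. *)
Lemma tail_act (J : finType) (t : J -> T) : exists k0 : nat, forall k : nat,
  (k0 <= k)%N -> forall j x,
    @lm_act _ _ M (hat (xt k x) 0) (t j) = \sum_i a i ^+ k *: site i x (t j).
Proof.
have /choice[k0 k0P] j := right_tail (t j).
exists (\max_j k0 j) => k /bigmax_leqP kk j x.
by rewrite tensor_act_split eval_partE k0P ?addr0 ?kk.
Qed.

Hypotheses (char0 : [pchar F] =i pred0) (a_inj : injective a).
Hypotheses (irrV : forall i, irreducible (V i)) (schurV : forall i, schur (V i)).
Hypothesis irrL : irreducible L.

(** Extraction at large k recovers the site operators; subtracting the evaluation part from the full
    action then recovers the action on L. *)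
Lemma eval_tensor_irreducible : irreducible M.
Proof.
split.
  have [v [l [v0 l0]]] := tensor_nonzero irrV irrL.
  by exists (pure v l); exact: pure_neq0.
move=> N subM; have sN := submodule_subspace subM.
have [N0 Nl Nx] := subM.
have siteN i : submodule (M := site_tensor V L i) N.
  split=> // x t Nt.
  have [k0 k0P] := tail_act (fun _ : unit => t).
  have ext := exp_poly_extract (D := id) char0 (n := 0)
    (y := fun i _ => site i x t) (k0 := k0) a_inj a_neq0 sN.
  apply: (ext _ i) => k /k0P/(_ tt x) kE; have := Nx (hat (xt k x) 0) _ Nt.
  rewrite kE; congr N; apply: eq_bigr => j _.
  by rewrite big_ord1 expr0 poly_act1.
have rightN : submodule (M := right_tensor V L) N.
  split=> // u t Nt; change (N (right u t)).
  rewrite (_ : right u t = @lm_act _ _ M u t - eval_part u.1 t).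
    apply: subspaceB => //; first exact: Nx.
    have pl := eval_part_linear_l t.
    elim/loop_ind: u.1 => [|f f' IH IH'|k x].
    - by rewrite (linear_fun0 pl).
    - by rewrite (linear_funD pl); exact: subspaceD.
    rewrite eval_partE; apply: subspace_sum => // i _; apply: subspaceZ => //.
    by have [_ _] := siteN i; exact.
  by rewrite tensor_act_split addrC addKr.
exact: (outer_tensor_irreducible irrV schurV irrL siteN rightN).
Qed.

End EvaluationTensor.

(** * Spanning the induced module by powers of d *)

Section IndGenerated.
Variables (F : fieldType) (g g' : lieAlgType F) (phi : g -> g') (M : lieMod g).
Hypotheses (phi_linear : linear phi)
  (phi_bracket : forall x y, phi (bracket x y) = bracket (phi x) (phi y)).

Definition ind_one (m : M) : Ind phi M := ind_pure phi (1 : env g') m.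

Lemma ind_one_linear : linear ind_one.
Proof. exact: ind_pure_linear_r. Qed.

Lemma ind_one_act x m :
  @lm_act _ _ (Ind phi M) (phi x) (ind_one m) = ind_one (lm_act x m).
Proof.
rewrite /= /ind_one ind_actE mulr1 -(env_map_inj phi_linear phi_bracket) -[env_map _ _]mul1r.
by rewrite ind_pure_balanced env_act_inj.
Qed.

Lemma ind_generated (W : set (Ind phi M)) :
  submodule W -> (forall m, W (ind_one m)) -> forall z, W z.
Proof.
move=> subW W1; have sW := submodule_subspace subW; have [_ _ Wx] := subW.
apply: (@spanned_of_ext F (ind_space phi M) (env g' * M) (fun p => ind_pure phi p.1 p.2)) => //.
  by move=> p q pl ql pq; apply: ind_ext => // u m; exact: (pq (u, m)).
case=> u m /=; have ll := ind_pure_linear_l phi m; case: (qmodP u) => p.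
elim/fsupp_ind: p => [|p q IHp IHq|w c].
- by rewrite linear0 (linear_fun0 ll); exact: (submodule_subspace subW).1.
- by rewrite linearD (linear_funD ll); exact: subspaceD.
elim: w => [|x w IH].
  rewrite (_ : fsingle [::] c = (c : F) *: (1 : freealg F g')); last first.
    by rewrite -[RHS](linear_funZ (@fsingle_linear _ _ F^o [::])) /GRing.scale /= mulr1.
  by rewrite linearZ (linear_funZ ll); apply: subspaceZ => //; exact: W1.
rewrite (_ : fsingle (x :: w) c = (@fgen F g' x : freealg F g') * fword w c); last first.
  by rewrite -[RHS]/(fmul (@fgen F g' x) (fword w c)) fmulE mul1r.
by rewrite env_piM -ind_actE; exact: Wx.
Qed.

End IndGenerated.

Section AffineInduced.
Variables (F : fieldType) (g : finLieAlgType F) (M : lieMod (affine_hat g)).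

Local Notation X := (ind_d M).
Local Notation one := (@ind_one F _ _ (@hat_incl F g) M).
Local Notation hat_act u := (@lm_act _ _ X (hat_incl u)).

Definition d_act : X -> X := @lm_act _ _ X ((0, 0, 1) : affine g).

Lemma d_act_linear : linear d_act.
Proof. exact: lm_act_linear_r. Qed.

Lemma hat_act_one u (m : M) : hat_act u (one m) = one (lm_act u m).
Proof. exact: ind_one_act (@hat_incl_linear F g) (@hat_incl_bracket F g) u m. Qed.

Lemma hat_act_d (u : affine_hat g) (z : X) :
  hat_act u (d_act z) = d_act (hat_act u z) - hat_act (loop_deriv u.1, 0) z.
Proof.
have <- : bracket ((0, 0, 1) : affine g) (hat_incl u) = hat_incl (loop_deriv u.1, 0).
  congr (_, _, _); last exact: linear_fun0 (loop_cocycle_linear_l u.1).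
  rewrite /= (linear_fun0 (loop_bracket_linear_l u.1)) (linear_fun0 (@loop_deriv_linear F g)).
  by rewrite scale1r add0r scaler0 subr0.
by rewrite lm_act_bracket opprB addrC subrK.
Qed.

Lemma xt_act_iter_d k x n (m : M) :
  hat_act (xt k x, 0) (iter n d_act (one m)) =
    poly_act d_act (('X - (k%:~R)%:P) ^+ n) (one (lm_act ((xt k x, 0) : affine_hat g) m)).
Proof.
have dl := d_act_linear.
elim: n => [|n IH]; first by rewrite expr0 poly_act1 hat_act_one.
rewrite iterS hat_act_d IH exprS poly_actM // poly_actXsubC //; congr (_ - _).
rewrite -IH; have zl := @lm_act_linear_l _ _ X (iter n d_act (one m)).
have -> : (loop_deriv (xt k x), 0) = k%:~R *: ((xt k x, 0) : affine_hat g).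
  by rewrite loop_derivE (linear_funZ (xt_linear k)); congr pair; rewrite /= scaler0.
by rewrite (linear_funZ (@hat_incl_linear F g)) (linear_funZ zl).
Qed.

Definition d_sum : nat -> (nat -> M) -> X := graded_sum (fun n m => iter n d_act (one m)).

Lemma iter_d_linear n : linear (fun m => iter n d_act (one m)).
Proof.
elim: n => [|n IH] c m m'; first exact: ind_one_linear.
by rewrite !iterS IH d_act_linear.
Qed.

(** These sums form a submodule containing 1 (x) M: moving an element of the smaller algebra past d
    leaves a commutator in that algebra applied to a lower power of d. *)
Lemma ind_d_sum (z : X) : exists n s, z = d_sum n s.
Proof.
have [G0 Gl] := graded_sums_subspace iter_d_linear.
have G1 n m := graded_sum_single iter_d_linear n m.
move: z; apply: ind_generated => [|m]; last exact: (G1 0).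
have sG : subspace (fun z => exists n s, z = d_sum n s) by split.
have dG z : (exists n s, z = d_sum n s) -> exists n s, d_act z = d_sum n s.
  move=> [n [s ->]]; rewrite /d_sum /graded_sum (linear_fun_sum _ _ _ d_act_linear).
  by apply: (subspace_sum sG) => j _; exact: (G1 j.+1).
split=> // u z [n [s ->]]; rewrite /d_sum /graded_sum.
rewrite (linear_fun_sum _ _ _ (@lm_act_linear_r _ _ X u)).
apply: (subspace_sum sG) => j _; set m := s j.
have hG : forall w : affine_hat g, exists n s, hat_act w (iter j d_act (one m)) = d_sum n s.
  elim: (j : nat) => [|i IH] w; first by rewrite hat_act_one; exact: (G1 0).
  by rewrite iterS hat_act_d; apply: (subspaceB sG) => //; exact: dG.
case: u => [[f c] b].
have -> : (f, c, b) = (b : F) *: ((0, 0, 1) : affine g) + hat_incl (f, c).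
  by congr (_, _, _); rewrite /= ?scaler0 ?add0r // addr0 regular_scale mulr1.
by rewrite lm_act_linear_l; apply: Gl => //; exact: (G1 j.+1).
Qed.

End AffineInduced.

(** * Irreducibility of M[d] *)

Section Irreducibility.
Variables (F : fieldType) (g : finLieAlgType F) (I : finType).
Variables (V : I -> lieMod g) (L : lieMod (affine_hat g)).
Variables (a : I -> F) (a_neq0 : forall i, a i != 0).
Hypothesis tailL : forall v : L, exists k0 : nat, forall k : nat, (0 < k)%N ->
  (k0 <= k)%N -> forall f, tail_loops k f -> lm_act ((f, 0) : affine_hat g) v = 0.
Hypotheses (char0 : [pchar F] =i pred0) (a_inj : injective a).
Hypotheses (irrV : forall i, irreducible (V i)) (schurV : forall i, schur (V i)).
Hypothesis irrL : irreducible L.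
Variables (i0 : I) (x0 : g) (v0 : V i0).
Hypothesis nontrivial : lm_act x0 v0 <> 0.

Local Notation M := (eval_tensor V L a_neq0).
Local Notation X := (ind_d M).
Local Notation one := (@ind_one F _ _ (@hat_incl F g) M).

(* Some site operator does not kill the leading coefficient of a nonzero      *)
(* [sum_j d^j (x) s j], and its value there is, up to sign, the coefficient   *)
(* of [a_i ^ k k ^ n] in the action of [x (x) t^k] on that sum, [k] large.    *)
Lemma submodule_meets_one (W : set X) n s : submodule W ->
  W (d_sum n s) -> d_sum n s <> 0 -> exists2 v : M, v <> 0 & W (one v).
Proof.
move=> subW; have sW := submodule_subspace subW.
elim: n => [|n IH]; first by rewrite /d_sum /graded_sum big_ord0.
have [sn0|sn0] := pselect (s n = 0).
  suff -> : d_sum n.+1 s = d_sum n s by [].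
  rewrite /d_sum /graded_sum big_ord_recr /= sn0 (linear_fun0 (iter_d_linear n)).
  by rewrite addr0.
move=> Wz _.
have [i [x sx0]] : exists i x, site i x (s n) <> 0.
  apply: contrapT => none; apply: sn0.
  apply: (site_invariants irrV schurV irrL nontrivial) => j y.
  by apply: contrapT => jy; apply: none; exists j, y.
exists (site i x (s n)) => //.
have [k0 k0P] := tail_act a_neq0 tailL (fun j : 'I_n.+1 => s j).
have ext := exp_poly_extract (D := @d_act F g M) char0 (n := n)
  (y := fun i (j : 'I_n.+1) => one (site i x (s j))) (k0 := k0) a_inj a_neq0 sW.
apply: (ext _ i) => k /k0P kE.
have [_ _ /(_ (hat_incl ((xt k x, 0) : affine_hat g)) _ Wz)] := subW.
rewrite /d_sum /graded_sum (linear_fun_sum _ _ _ (@lm_act_linear_r _ _ X _)).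
congr W; rewrite exchange_big; apply: eq_bigr => j _; rewrite xt_act_iter_d kE.
have pl := poly_act_linear_r (@d_act_linear F g M) (('X - k%:R%:P) ^+ j).
rewrite (linear_fun_sum _ _ _ (@ind_one_linear F _ _ (@hat_incl F g) M)).
rewrite (linear_fun_sum _ _ _ pl); apply: eq_bigr => i' _.
by rewrite (linear_funZ (@ind_one_linear F _ _ (@hat_incl F g) M)) (linear_funZ pl).
Qed.

(** The m with 1 (x) m in W form a submodule of M, nonzero by [submodule_meets_one], hence all of M;
    and 1 (x) M generates M[d]. *)
Lemma ind_d_eval_tensor_irreducible : irreducible X.
Proof.
have irrM := eval_tensor_irreducible a_neq0 tailL char0 a_inj irrV schurV irrL.
split=> [|W subW].
  have [[m m0] _] := irrM; exists (one m) => m1; apply: m0.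
  exact: ind_d_pure1_inj m1.
have [zero|] := pselect (forall z, W z -> z = 0); first by left.
move=> /existsNP[z /not_implyP[Wz z0]]; right.
have [W0 Wl Wx] := subW.
have [n [s zE]] := ind_d_sum z; rewrite zE in Wz z0.
have [v v_neq0 Wv] := submodule_meets_one subW Wz z0.
apply: (ind_generated subW).
have [|zero|//] := irrM.2 [set m | W (one m)]%classic; last by case: v_neq0; exact: zero.
split=> [|c u w /= Wu Ww|u w /= Ww].
- by rewrite /= (linear_fun0 (@ind_one_linear F _ _ (@hat_incl F g) M)).
- by rewrite ind_one_linear; exact: Wl.
- by rewrite -hat_act_one; exact: Wx.
Qed.

End Irreducibility.

Unset Implicit Arguments.

Theorem corollary3p5 (R : realType) (g : finLieAlgType R[i]) (h : {vspace g})
    (D : seq (hdual h)) (L : lieMod (affine_hat g)) (m : nat)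
    (a : 'I_m -> R[i]) (lambda : {ffun 'I_m -> hdual h}) (V : 'I_m -> lieMod g) :
  simple_lie g ->
  cartan_subalgebra h ->
  is_base D ->
  irreducible L ->
  (forall v : L, exists k0 : nat, forall k : nat, (0 < k)%N -> (k0 <= k)%N ->
     forall f : loop g, tail_loops k f -> lm_act ((f, 0) : affine_hat g) v = 0) ->
  (0 < m)%N ->
  forall a_neq0 : (forall i, a i != 0),
  injective a ->
  lambda != 0 ->
  (forall i, irreducible_highest_weight D (lambda i) (V i)) ->
  irreducible (ind_d (tensor_mod (eval_mod V a_neq0) L)).
Proof.
move=> _ _ _ irrL tailL _ a_neq0 a_inj lambda0 hwV.
have irrV i : irreducible (V i) by case: (hwV i).
have schurV i : schur (V i) := irreducible_schur (@complex_uncountable R) (irrV i).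
(* A nonzero weight lambda_i is nonzero at some t in h, and t scales the highest weight vector of
   V_i by that value. *)
have [i [x [v xv]]] : exists i x (v : V i), lm_act x v <> 0.
  have [i li] : exists i, lambda i != 0.
    apply: contrapT => /forallNP l0; move/eqP: lambda0; apply.
    by apply/ffunP => i; rewrite ffunE; have /negP/negPn/eqP := l0 i.
  have [t lt] : exists t, lambda i t != 0.
    apply: contrapT => /forallNP l0; move/eqP: li; apply; apply/lfunP => t.
    by rewrite lfunE /=; have /negP/negPn/eqP := l0 t.
  have [[v [v0 _ vt] _] _] := hwV i.
  exists i, (vsval t), v; rewrite vt => /eqP.
  by rewrite scaler_eq0 (negPf lt) /= => /eqP.
exact: (ind_d_eval_tensor_irreducible a_neq0 tailL (@pchar_num _) a_inj
  irrV schurV irrL xv).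
Qed.
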